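(* Let $(A,\Phi)\in\mathbf{AP}$ satisfy $\inf_{q\in\Lambda}\mathcal I(q)<0$. Then there exists a non-constant $\mathbf q\in\mathcal K_\Lambda$ such that $\mathcal I(\mathbf q)=\min_{q\in\Lambda}\mathcal I(q)$.
   Context: Fix $T>0$ and a compact $\mathcal S\subset\mathbb R^3$ (possibly empty), $\mathcal S^c=\mathbb R^3\setminus\mathcal S$. $\mathcal A$ is the set of $A\in\mathcal C^1(\mathbb R^4;\mathbb R^3)$, $A=A(t,x)$, $T$-periodic in $t$, with $\partial_tA\not\equiv0$ and $\lim_{|x|\to\infty}(|\partial_tA|+|\nabla A|)=0$ uniformly in $t$ ($\nabla$ = spatial derivative). $\mathcal P$ is the set of $\Phi:\mathbb R\times\mathcal S^c\to\mathbb R$ bounded above, $T$-periodic and continuous in $t$, $\Phi(t,\cdot)\in\mathcal C^1(\mathcal S^c)$, $\lim_{|x|\to\infty}|\nabla\Phi(t,x)|=0$ uniformly in $t$, and, if $\mathcal S\ne\emptyset$, for each $x_0\in\partial\mathcal S$, $t_0\in[0,T]$ there are $\varepsilon,r>0$ with $-\Phi(t,x)\ge r/|x-x_0|$ whenever $|x-x_0|,|t-t_0|<\varepsilon$, $x\in\mathcal S^c$. $\varphi(x)=\int_0^T\Phi(t,x)dt$, normalized so that $\sup_{\mathcal S^c}\varphi=0$. $\mathbf{AP}$ = pairs $(A,\Phi)\in\mathcal A\times\mathcal P$ with $\partial_tA+\nabla\Phi\not\equiv0$. $\mathcal W$ = Lipschitz $T$-periodic $q:\mathbb R\to\mathbb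 R^3$ with norm $\|q\|_\infty+\|\dot q\|_\infty$; $\mathcal K=\{q\in\mathcal W:\|\dot q\|_\infty\le1\}$; $\Lambda=\{q\in\mathcal W: q(t)\notin\mathcal S\ \forall t\}$; $\mathcal K_\Lambda=\mathcal K\cap\Lambda$. $\mathcal I(q)=\int_0^T(1-\sqrt{1-|\dot q|^2})dt+\int_0^T(\dot q\cdot A(t,q)-\Phi(t,q))dt$ for $q\in\mathcal K_\Lambda$ and $\mathcal I(q)=+\infty$ for $q\in\Lambda\setminus\mathcal K_\Lambda$. *)

(* Defs.v *)
From HB Require Import structures.
From mathcomp Require Import all_boot all_order all_algebra.
From mathcomp Require Import all_classical all_reals all_analysis.
Set Implicit Arguments. Unset Strict Implicit. Unset Printing Implicit Defensive.
Import Order.TTheory GRing.Theory Num.Theory.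
Import numFieldNormedType.Exports.
Local Open Scope classical_set_scope.
Local Open Scope ring_scope.

Section Defs.
Variable R : realType.

Definition V3 := 'rV[R]_3.

Definition dot3 (u v : V3) : R := \sum_(i < 3) u ord0 i * v ord0 i.
Definition enorm (u : V3) : R := Num.sqrt (dot3 u u).

Definition evec (i : 'I_3) : V3 := \row_(j < 3) (i == j)%:R.

Definition dt {W : normedModType R} (f : R -> V3 -> W) (t : R) (x : V3) : W :=
  derive1 (fun s => f s x) t.
Definition dx {W : normedModType R} (f : R -> V3 -> W) (i : 'I_3) (t : R) (x : V3) : W :=
  derive1 (fun s => f t (x + s *: evec i)) 0.

Definition gradx (f : R -> V3 -> R) (t : R) (x : V3) : V3 :=
  \row_(i < 3) dx f i t x.

Definition jacnorm (f : R -> V3 -> V3) (t : R) (x : V3) : R :=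
  Num.sqrt (\sum_(i < 3) enorm (dx f i t x) ^+ 2).

Definition C1_R4 (f : R -> V3 -> V3) : Prop :=
  (forall (t : R) (x : V3), derivable (fun s : R => f s x) t 1) /\
  (forall (t : R) (x : V3) (i : 'I_3), derivable (fun s : R => f t (x + s *: evec i)) 0 1) /\
  continuous (fun p : R * V3 => dt f p.1 p.2) /\
  (forall i, continuous (fun p : R * V3 => dx f i p.1 p.2)).

Definition classA (T : R) (A : R -> V3 -> V3) : Prop :=
  C1_R4 A /\
  (forall t x, A (t + T) x = A t x) /\
  (exists t x, dt A t x != 0) /\
  (forall e, 0 < e -> exists M : R, forall t x, M < enorm x ->
      enorm (dt A t x) + jacnorm A t x < e).

(* the class \mathcal P (S is the compact obstacle, S^c = ~` S) *)
Definition classP (T : R) (S : set V3) (Phi : R -> V3 -> R) : Prop :=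
  (exists c : R, forall t x, ~ S x -> Phi t x <= c) /\
  (forall t x, ~ S x -> Phi (t + T) x = Phi t x) /\
  (forall x, ~ S x -> continuous (fun t => Phi t x)) /\
  (forall (t : R) (x : V3) (i : 'I_3), ~ S x -> derivable (fun s : R => Phi t (x + s *: evec i)) 0 1) /\
  (forall t i, {within ~` S, continuous (fun x => dx Phi i t x)}) /\
  (forall e, 0 < e -> exists M : R, forall t x, ~ S x -> M < enorm x ->
      enorm (gradx Phi t x) < e) /\
  (S !=set0 -> forall x0 t0, (closure S `\` interior S) x0 -> 0 <= t0 <= T ->
     exists eps r : R, 0 < eps /\ 0 < r /\
       forall t x, ~ S x -> enorm (x - x0) < eps -> `|t - t0| < eps ->
         r / enorm (x - x0) <= - Phi t x).

Definition phi (T : R) (Phi : R -> V3 -> R) (x : V3) : \bar R :=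
  (\int[@lebesgue_measure R]_(t in `[0%R, T]) (Phi t x)%:E)%E.

Definition classAP (T : R) (S : set V3) (A : R -> V3 -> V3) (Phi : R -> V3 -> R) : Prop :=
  classA T A /\ classP T S Phi /\
  ~ (forall t x, ~ S x -> dt A t x + gradx Phi t x = 0).

Definition inW (T : R) (q : R -> V3) : Prop :=
  (exists L : R, forall s t, enorm (q s - q t) <= L * `|s - t|) /\
  (forall t, q (t + T) = q t).

Definition inK (T : R) (q : R -> V3) : Prop :=
  inW T q /\ {ae @lebesgue_measure R, forall t, enorm (derive1 q t) <= 1}.

Definition inLambda (T : R) (S : set V3) (q : R -> V3) : Prop :=
  inW T q /\ forall t, ~ S (q t).

Definition inKLambda (T : R) (S : set V3) (q : R -> V3) : Prop :=
  inK T q /\ inLambda T S q.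

Definition action (T : R) (S : set V3) (A : R -> V3 -> V3) (Phi : R -> V3 -> R)
  (q : R -> V3) : \bar R :=
  if `[< inKLambda T S q >] then
    ((\int[@lebesgue_measure R]_(t in `[0%R, T])
        (1 - Num.sqrt (1 - enorm (derive1 q t) ^+ 2))%:E) +
     (\int[@lebesgue_measure R]_(t in `[0%R, T])
        (dot3 (derive1 q t) (A t (q t)) - Phi t (q t))%:E))%E
  else +oo%E.

End Defs.

(* Main.v *)
(* The direct method. A Lipschitz curve is the integral of its derivative: add
   a linear function to make it nondecreasing, take the Radon-Nikodym density
   of its Stieltjes measure and apply Lebesgue differentiation. Hence the
   curves of [inK] are exactly the periodic 1-Lipschitz ones.

   Since [A] has bounded derivatives and [Phi] is bounded above, the action is
   bounded below; since the derivatives of [A] and [Phi] vanish at infinity and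
   [phi <= 0], curves that start far away have almost nonnegative action. As the
   infimum is negative, a minimizing sequence is therefore bounded and has a
   pointwise convergent subsequence. Its limit avoids [S]: the blow-up of
   [- Phi] at the boundary of [S] would give [\int dt / |t - t0| = +oo].

   For lower semicontinuity, the potential term is handled by Fatou's lemma.
   By Jensen's inequality the kinetic and magnetic terms of each curve dominate,
   up to a uniform error [O(1/n)], a Riemann sum depending only on its values
   at [n] points; these sums pass to the limit along the sequence, and for the
   limit curve they converge to the integral by dominated convergence. Constant
   curves have nonnegative action, so the minimizer is not constant. *)
Require Import Defs.
From HB Require Import structures.
From mathcomp Require Import all_boot all_order all_algebra.
From mathcomp Require Import all_classical all_reals all_analysis.
From mathcomp Require Import measurable_realfun.
From mathcomp Require Import ring lra.
Import Order.TTheory GRing.Theory Num.Theory.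
Import numFieldNormedType.Exports.
Local Open Scope classical_set_scope.
Local Open Scope ring_scope.

Set Implicit Arguments.
Unset Strict Implicit.
Unset Printing Implicit Defensive.

(** * Lipschitz functions of one variable as integrals of bounded densities *)

Section lipschitz_density.
Variable R : realType.
Implicit Types (f F : R -> R) (L : R).
Local Notation mu := (@lebesgue_measure R).

Definition lip L f := forall s t, `|f s - f t| <= L * `|s - t|.

Lemma lip_continuous L f : lip L f -> continuous f.
Proof.
move=> lf x; apply/cvgrPdist_le => e e0.
have L1 : 0 < `|L| + 1 by rewrite ltr_wpDl.
near=> y.
apply: (le_trans (lf _ _)); apply: (@le_trans _ _ ((`|L| + 1) * `|x - y|)).
  by rewrite ler_wpM2r// (le_trans (ler_norm L))// lerDl.
rewrite mulrC -ler_pdivlMr//; near: y.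
by apply: cvgr_dist_le => //; rewrite divr_gt0.
Unshelve. all: by end_near. Qed.

Lemma lip_derive_le L f t D : (forall s, `|f s - f t| <= L * `|s - t|) ->
  is_derive t 1 f D -> `|D| <= L.
Proof.
move=> lf df; have df1 := @ex_derive _ _ _ _ _ _ _ df.
rewrite -(@derive_val _ _ _ _ _ _ _ df).
have : h^-1 *: (f (h *: 1 + t) - f t) @[h --> 0^'] --> 'D_1 f t by exact: df1.
move=> /cvgrPdist_le df2; apply/ler_addgt0Pr => e /df2 {}df2.
near (0:R)^' => h.
rewrite -(subrK (h^-1 *: (f (h *: 1 + t) - f t)) ('D_1 f t)).
rewrite (le_trans (ler_normD _ _))// addrC lerD//; last first.
  by near: h.
rewrite normrZ normfV ler_pdivrMl ?normr_gt0.
  by apply: (le_trans (lf _)); rewrite addrK [h *: 1]mulr1 mulrC.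
by near: h; exact: nbhs_dnbhs_neq.
Unshelve. all: by end_near. Qed.

Lemma ae_imp (P Q : R -> Prop) : (forall x, P x -> Q x) ->
  {ae mu, forall x, P x} -> {ae mu, forall x, Q x}.
Proof. by move=> PQ; apply: filterS => //; exact: (ae_filter_ringOfSetsType mu). Qed.

Lemma ae_imp2 (P Q S : R -> Prop) : (forall x, P x -> Q x -> S x) ->
  {ae mu, forall x, P x} -> {ae mu, forall x, Q x} -> {ae mu, forall x, S x}.
Proof. by move=> PQ; apply: filterS2 => //; exact: (ae_filter_ringOfSetsType mu). Qed.

Lemma ae_neq (b : R) : {ae mu, forall t, t != b}.
Proof.
exists [set b]; split => //; first exact: lebesgue_measure_set1.
by move=> t /= /negP; rewrite negbK => /eqP.
Qed.

Lemma bounded_integrable_itv (x y : itv_bound R) (c d : R) (g : R -> R) (M : R) :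
  [set` Interval x y] `<=` `[c, d] -> measurable_fun [set` Interval x y] g ->
  (forall t, [set` Interval x y] t -> `|g t| <= M) ->
  mu.-integrable [set` Interval x y] (EFin \o g).
Proof.
move=> xycd mg gM; apply: measurable_bounded_integrable => //.
  apply: (@le_lt_trans _ _ (mu `[c, d]%classic)).
    by apply: le_measure => //; rewrite inE.
  by rewrite lebesgue_measure_itv /=; case: ifP => _; rewrite -?EFinB ltry.
exists M; split; first exact: num_real.
by move=> z Mz t /gM/le_trans; apply; exact: ltW.
Qed.

Lemma Rintegral_cst_itv (x y : bool) (c d r : R) : c <= d ->
  \int[mu]_(t in [set` Interval (BSide x c) (BSide y d)]) r = r * (d - c).
Proof.
move=> cd; rewrite Rintegral_cst//; congr (_ * _).
transitivity (fine (d - c)%:E) => //; congr fine.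
apply: (eq_trans (lebesgue_measure_itv _)); rewrite /= lte_fin.
move: cd; rewrite le_eqVlt => /predU1P[->|->//].
by rewrite ltxx subrr.
Qed.

Section cumul.
Variables (L : R) (f : R -> R) (lf : lip L f).
Definition lip_cumul (x : R) := f x + L * x.

Lemma lip_cumul_nd : {homo lip_cumul : x y / x <= y}.
Proof.
move=> x y xy; rewrite /lip_cumul; have := lf x y.
rewrite ler_norml => /andP[_]; rewrite distrC ger0_norm ?subr_ge0// => ?; lra.
Qed.

Lemma lip_cumul_lip x y : x <= y -> lip_cumul y - lip_cumul x <= (2 * L) * (y - x).
Proof.
move=> xy; rewrite /lip_cumul; have := lf y x.
rewrite ler_norml => /andP[_]; rewrite ger0_norm ?subr_ge0// => ?; lra.
Qed.

Lemma lip_cumul_rc : right_continuous lip_cumul.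
Proof.
apply: right_continuousW => x; apply: cvgD; first exact: (lip_continuous lf).
by apply: cvgM; [exact: cvg_cst|exact: cvg_id].
Qed.

HB.instance Definition _ := isCumulative.Build R _ R lip_cumul lip_cumul_nd lip_cumul_rc.


Let nu : {measure set (measurableTypeR R) -> \bar R} :=
  lebesgue_stieltjes_measure lip_cumul.

Lemma lip_L_ge0 : 0 <= L.
Proof. by have := lf 1 0; rewrite subr0 normr1 mulr1; apply: le_trans. Qed.

Let wlength_le (X : set (ocitv_type R)) : ocitv X ->
  (wlength lip_cumul X <= (2 * L)%:E * wlength idfun X)%E.
Proof.
move=> /ocitvP[->|[[a b] /= ab ->]]; first by rewrite !wlength0 mule0.
rewrite !wlength_itv_bnd ?(ltW ab)// -EFinM lee_fin.
exact/lip_cumul_lip/ltW.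
Qed.

(** Lebesgue measure is an infimum over countable covers by half-open intervals, and on each of them
    the Stieltjes length is at most [2 * L] times the length. A cover of a null set of total length
    at most [e / (2 * L + 1)] therefore has Stieltjes mass at most [e]; the [+ 1] keeps the divisor
    positive when [L = 0]. *)
Let nu_dom : nu `<< mu.
Proof.
apply/null_content_dominatesP => A mA A0.
have L0 := lip_L_ge0.
apply/eqP; rewrite eq_le measure_ge0 andbT; apply/lee_addgt0Pr => e e0.
rewrite add0e.
have : ((mu A) < (e / (2 * L + 1))%:E)%E by rewrite A0 lte_fin divr_gt0//; lra.
move=> /ereal_inf_lt[_ [B [mB AB] <-] /ltW Be].
apply: (@le_trans _ _ (\sum_(0 <= k <oo) wlength lip_cumul (B k))%E).
  by apply: ereal_inf_lbound; exists B.
apply: (@le_trans _ _ (\sum_(0 <= k <oo) ((2 * L)%:E * wlength idfun (B k)))%E).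
  by apply: lee_nneseries => [k _ _|k _]; [exact: wlength_ge0|apply: wlength_le; exact: mB].
rewrite nneseriesZl; last by move=> k _; exact: wlength_ge0.
apply: (le_trans (lee_wpmul2l _ Be)); first by rewrite lee_fin; lra.
rewrite -EFinM lee_fin mulrA ler_pdivrMr; nra.
Qed.

Variables (a b : R).
Hypothesis ab : a < b.

Let mab : measurable (`]a, b]%classic : set (measurableTypeR R)). Proof. by []. Qed.
Let nuE c d : c <= d -> nu `]c, d]%classic = (lip_cumul d - lip_cumul c)%:E.
Proof.
move=> cd; rewrite /nu /= /lebesgue_stieltjes_measure /measure_extension/=.
by rewrite measurable_mu_extE/= ?wlength_itv_bnd//; exact: is_ocitv.
Qed.
Let nuoo : (nu `]a, b]%classic < +oo)%E. Proof. by rewrite nuE ?ltW// ltry. Qed.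

(** The Radon-Nikodym theorem is applied to the restriction of [nu] to []a, b]], which is a finite
    measure; this is why the increments are recovered only inside [[a, b]]. *)
Let density0 : exists g1 : R -> R, mu.-integrable setT (EFin \o g1) /\
  forall c d, a <= c -> c <= d -> d <= b ->
    \int[mu]_(t in `]c, d]) g1 t = lip_cumul d - lip_cumul c.
Proof.
pose nu' : {finite_measure set _ -> \bar R} := mfrestr mab nuoo.
have nu'_dom : nu' `<< mu.
  apply/null_content_dominatesP => A mA A0; rewrite /nu'/= /mfrestr/= /mrestr.
  move/null_content_dominatesP : nu_dom; apply; first exact: measurableI.
  apply/eqP; rewrite eq_le measure_ge0 andbT -A0 le_measure// ?inE//.
  exact: measurableI.
have [h [h0 hfin inth nuh]] := radon_nikodym_sigma_finite nu'_dom.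
pose g1 : R -> R := fine \o h.
have hE : h = EFin \o g1 by apply/funext => x; rewrite /= fineK.
have ing1 : mu.-integrable (setT : set R) (EFin \o g1) by rewrite -hE.
exists g1; split=> // c d ac cd db; transitivity (fine (nu' `]c, d]%classic)).
  by rewrite nuh// hE.
rewrite /nu'/= /mfrestr/= /mrestr setIidl ?nuE// => x; rewrite /= !in_itv/= => /andP[? ?].
by rewrite (le_lt_trans ac)//= (le_trans _ db).
Qed.

Lemma lip_density : exists g : R -> R,
  [/\ measurable_fun setT g, forall t, `|g t| <= L,
    (forall c d, a <= c -> c <= d -> d <= b ->
      \int[mu]_(t in `[c, d]) g t = f d - f c) &
    {ae mu, forall t, a < t < b -> is_derive t 1 f (g t)}].
Proof.
have [g1 [ing1 intg1]] := density0.
have mg1 : measurable_fun setT g1.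
  by have /measurable_int/measurable_EFinP := ing1.
have dg1 : {ae mu, forall t, a < t < b -> is_derive t 1 f (g1 t - L)}.
  have intY y : mu.-integrable [set` Interval (BRight a) (BRight y)] (EFin \o g1).
    by apply: (integrableS _ _ _ ing1).
  have /= := FTC1 intY (open_integrable_locally openT ing1).
  apply: ae_imp => t + /andP[at_ tb]; rewrite lte_fin => /(_ at_) [dF F'].
  pose F2 (x : R) : R := \int[mu]_(t in `]a, x]) g1 t.
  have dF2 : is_derive t 1 F2 (g1 t).
    by apply: DeriveDef; [exact: dF|rewrite -derive1E; exact: F'].
  have H := is_deriveB (is_deriveD dF2 (is_derive_cst (lip_cumul a) t 1)) (is_deriveZ L (is_derive_id t 1)).
  have -> : g1 t - L = g1 t + 0 - L *: 1 by rewrite addr0 /GRing.scale/= mulr1.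
  (* [F2] is known to be an increment of [lip_cumul] only on [[a, b]], so [f] agrees with
     [F2 + lip_cumul a - L * x] merely in a neighbourhood of [t], which is enough for the
     derivative. *)
  apply: near_eq_is_derive H.
  near=> x.
  have -> : (F2 + cst (lip_cumul a) - L \*: id) x = F2 x + lip_cumul a - L * x by [].
  rewrite /F2 intg1 ?subrK /lip_cumul ?addrK//.
  - by apply: ltW; near: x; exact: lt_nbhsr.
  - by apply: ltW; near: x; exact: lt_nbhsl.
(* Clamping to [[- L, L]] makes the bound hold at every point. It changes nothing almost everywhere
   on []a, b[], where [g1 t - L] is a derivative of the [L]-Lipschitz function [f]. *)
exists (fun t => Num.max (- L) (Num.min L (g1 t - L))).
have L0 := lip_L_ge0.
have mg : measurable_fun setT (fun t => Num.max (- L) (Num.min L (g1 t - L))).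
  apply: measurable_maxr; first exact: measurable_cst.
  apply: measurable_minr; first exact: measurable_cst.
  by apply: measurable_funB => //; exact: measurable_cst.
have bg t : `|Num.max (- L) (Num.min L (g1 t - L))| <= L.
  by rewrite ler_norml le_max lexx/= ge_max ge_min lexx/= andbT; lra.
have aeg : {ae mu, forall t, a < t < b -> Num.max (- L) (Num.min L (g1 t - L)) = g1 t - L /\ is_derive t 1 f (g1 t - L)}.
  apply: ae_imp dg1 => t /[apply] df; split => //.
  suff : `|g1 t - L| <= L.
    by rewrite ler_norml => /andP[h1 h2]; rewrite min_r// max_r.
  by apply: lip_derive_le df => s; exact: lf.
split => //; last by apply: ae_imp aeg => t /[apply] -[->].
move=> c d ac cd db.
have sub : [set` `]c, d]] `<=` [set` `[c, d]] by apply: subset_itvr; rewrite bnd_simp.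
have ing0 : mu.-integrable `]c, d] (EFin \o (fun t => Num.max (- L) (Num.min L (g1 t - L)))).
  by apply: (bounded_integrable_itv (M := L) sub) => //; exact: measurable_funTS.
have ing2 : mu.-integrable `]c, d] (EFin \o g1) by exact: (integrableS measurableT _ _ ing1).
have ing3 : mu.-integrable `]c, d] (EFin \o cst L).
  by apply: (bounded_integrable_itv (M := `|L|) sub).
rewrite -Rintegral_itv_obnd_cbnd//.
transitivity (\int[mu]_(t in `]c, d]) (g1 t - L)).
  congr fine; apply: ae_eq_integral => //.
  - by apply/measurable_EFinP; exact: measurable_funTS.
  - by apply/measurable_EFinP; apply: measurable_funB => //; exact: measurable_funTS.
  - apply: ae_imp2 aeg (ae_neq b) => t + tb; rewrite /= in_itv/= => + /andP[ct td].
    rewrite (le_lt_trans ac ct) lt_neqAle tb (le_trans td db)/= => /(_ isT)[-> _] //.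
rewrite RintegralB// intg1//.
by rewrite (Rintegral_cst_itv _ _ L cd) /lip_cumul; ring.
Unshelve. all: by end_near. Qed.
End cumul.
End lipschitz_density.

(** * The Euclidean norm on 3-space and its comparison with the maximum norm *)

Section euclid.
Variable R : realType.
Implicit Types u v w : V3 R.

Lemma dot3E u v : dot3 u v = u ord0 ord0 * v ord0 ord0 +
  u ord0 1%R * v ord0 1%R + u ord0 2%:R * v ord0 2%:R.
Proof.
rewrite /dot3 !big_ord_recl big_ord0 addr0 -addrA; do 2 congr (_ + _).
  by congr (u ord0 _ * v ord0 _); apply: val_inj.
by congr (u ord0 _ * v ord0 _); apply: val_inj.
Qed.

Lemma dot3C u v : dot3 u v = dot3 v u.
Proof. by apply: eq_bigr => i _; rewrite mulrC. Qed.

Lemma dot3Dl u v w : dot3 (u + v) w = dot3 u w + dot3 v w.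
Proof. by rewrite /dot3 -big_split; apply: eq_bigr => i _; rewrite mxE mulrDl. Qed.

Lemma dot3Zl (a : R) u v : dot3 (a *: u) v = a * dot3 u v.
Proof. by rewrite /dot3 mulr_sumr; apply: eq_bigr => i _; rewrite mxE mulrA. Qed.

Lemma dot3Nl u v : dot3 (- u) v = - dot3 u v.
Proof. by rewrite -scaleN1r dot3Zl mulN1r. Qed.

Lemma dot3Bl u v w : dot3 (u - v) w = dot3 u w - dot3 v w.
Proof. by rewrite dot3Dl dot3Nl. Qed.

Lemma dot3Br u v w : dot3 u (v - w) = dot3 u v - dot3 u w.
Proof. by rewrite dot3C dot3Bl !(dot3C u). Qed.

Lemma dot30l u : dot3 0 u = 0.
Proof. by rewrite -(scale0r 0) dot3Zl mul0r. Qed.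

Lemma dot3_ge0 u : 0 <= dot3 u u.
Proof. by apply: sumr_ge0 => i _; rewrite -expr2 sqr_ge0. Qed.

Lemma enorm_ge0 u : 0 <= enorm u. Proof. exact: sqrtr_ge0. Qed.

Lemma enorm_sqr u : enorm u ^+ 2 = dot3 u u.
Proof. by rewrite sqr_sqrtr// dot3_ge0. Qed.

Lemma enorm0 : enorm (0 : V3 R) = 0. Proof. by rewrite /enorm dot30l sqrtr0. Qed.

Lemma enormZ (a : R) u : enorm (a *: u) = `|a| * enorm u.
Proof.
by rewrite /enorm dot3Zl dot3C dot3Zl mulrA -expr2 sqrtrM ?sqr_ge0// sqrtr_sqr.
Qed.

Lemma enormN u : enorm (- u) = enorm u.
Proof. by rewrite -scaleN1r enormZ normrN1 mul1r. Qed.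

Lemma enormB u v : enorm (u - v) = enorm (v - u).
Proof. by rewrite -enormN opprB. Qed.

(** Lagrange's identity: the difference of the squares is the squared length of the cross product, a
    sum of three squares. *)
Lemma ler_dot3 u v : `|dot3 u v| <= enorm u * enorm v.
Proof.
rewrite -ler_sqr ?nnegrE ?mulr_ge0 ?enorm_ge0// exprMn !enorm_sqr.
rewrite real_normK ?num_real// -subr_ge0 !dot3E.
set a := u _ _; set b := u _ _; set c := u _ _.
set x := v _ _; set y := v _ _; set z := v _ _.
rewrite (_ : _ - _ = (a * y - b * x) ^+ 2 + (a * z - c * x) ^+ 2 + (b * z - c * y) ^+ 2).
  by rewrite !addr_ge0 ?sqr_ge0.
by ring.
Qed.

Lemma ler_enormD u v : enorm (u + v) <= enorm u + enorm v.
Proof.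
rewrite -ler_sqr ?nnegrE ?addr_ge0 ?enorm_ge0// sqrrD !enorm_sqr.
rewrite dot3Dl !(dot3C _ (u + v)) !dot3Dl (dot3C v u).
have := ler_dot3 u v; rewrite ler_norml => /andP[_]; rewrite mulr2n; lra.
Qed.

Lemma ler_enorm_sub u v : enorm u <= enorm (u - v) + enorm v.
Proof. by rewrite -{1}(subrK v u) ler_enormD. Qed.

Lemma ler_coord_enorm u i : `|u ord0 i| <= enorm u.
Proof.
rewrite -ler_sqr ?nnegrE ?enorm_ge0// enorm_sqr real_normK ?num_real//.
rewrite /dot3 (bigD1 i)//= -expr2 lerDl sumr_ge0// => j _.
by rewrite -expr2 sqr_ge0.
Qed.

Lemma ler_enorm_sum u : enorm u <= \sum_i `|u ord0 i|.
Proof.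
rewrite -ler_sqr ?nnegrE ?enorm_ge0 ?sumr_ge0// enorm_sqr dot3E.
rewrite !big_ord_recl big_ord0 addr0 addrA.
rewrite (_ : lift ord0 ord0 = 1%R); last exact: val_inj.
rewrite (_ : lift ord0 _ = 2%:R); last exact: val_inj.
set a := u _ _; set b := u _ _; set c := u _ _.
rewrite -!expr2 -(real_normK (num_real a)) -(real_normK (num_real b)) -(real_normK (num_real c)).
have := normr_ge0 a; have := normr_ge0 b; have := normr_ge0 c.
move: (`|a|) (`|b|) (`|c|) => x y z *; nra.
Qed.

Lemma ler_norm_enorm u : `|u| <= enorm u.
Proof.
rewrite [leLHS]/Num.Def.normr/= mx_normrE; apply: bigmax_le; first exact: enorm_ge0.
by move=> [i j] _ /=; rewrite (ord1 i) ler_coord_enorm.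
Qed.

Lemma ler_coord_norm u i : `|u ord0 i| <= `|u|.
Proof.
rewrite [leRHS]/Num.Def.normr/= mx_normrE.
exact: (@le_bigmax _ _ _ 0 (fun k : 'I_1 * 'I_3 => `|u k.1 k.2|) (ord0, i)).
Qed.

Lemma ler_enorm_norm u : enorm u <= 3 * `|u|.
Proof.
apply: (le_trans (ler_enorm_sum u)).
rewrite !big_ord_recl big_ord0.
by have := ler_coord_norm u ord0; have := ler_coord_norm u (lift ord0 ord0);
  have := ler_coord_norm u (lift ord0 (lift ord0 ord0)); lra.
Qed.

Lemma enorm_eq0 u : enorm u = 0 -> u = 0.
Proof. by move=> u0; apply/normr0_eq0/le_anti; rewrite normr_ge0 andbT -u0 ler_norm_enorm. Qed.

(** The topology of row vectors comes from the maximum norm; the two norms are equivalent with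
    constants 1 and 3, so limits can be tested with [enorm]. *)
Lemma cvg_enormP {T : Type} (F : set_system T) {FF : Filter F} (f : T -> V3 R) (l : V3 R) :
  f @ F --> l <-> enorm (f x - l) @[x --> F] --> 0.
Proof.
split => [fl|/cvgr0Pnorm_le fl].
  apply/cvgr0Pnorm_le => e e0; near=> x.
  rewrite ger0_norm ?enorm_ge0//; apply: (le_trans (ler_enorm_norm _)).
  rewrite -ler_pdivlMl// distrC; near: x.
  by apply: (cvgrPdist_le _ _).1 => //; rewrite mulr_gt0.
apply/cvgrPdist_le => e /fl; apply: filterS => x.
by rewrite distrC ger0_norm ?enorm_ge0//; apply: le_trans; exact: ler_norm_enorm.
Unshelve. all: by end_near. Qed.

Lemma enorm_continuous : continuous (@enorm R : 'rV[R]_3 -> R).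
Proof.
move=> x; apply/(@cvgrPdist_le _ _ _ _ (nbhs_filter x)) => e e0.
have := (@cvg_enormP _ (nbhs x) (nbhs_filter x) (fun y : V3 R => y) x).1 (@cvg_id _ (nbhs x)).
move=> /cvgr0Pnorm_le/(_ _ e0); apply: filterS => y.
rewrite ger0_norm ?enorm_ge0//; apply: le_trans.
rewrite ler_norml; apply/andP; split.
  by have := ler_enorm_sub y x; lra.
by have := ler_enorm_sub x y; rewrite enormB; lra.
Qed.

End euclid.

(** * Velocities of Lipschitz curves, and [inK] as the periodic 1-Lipschitz curves *)

Section velocity.
Variable R : realType.
Local Notation mu := (@lebesgue_measure R).
Implicit Types (q g : R -> V3 R) (D : set R).

Definition mvec D g := forall i, measurable_fun D (fun t => g t ord0 i).

Lemma mvec_dot3 D g h : mvec D g -> mvec D h -> measurable_fun D (fun t => dot3 (g t) (h t)).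
Proof.
move=> mg mh; rewrite /dot3.
by apply: measurable_sum => i; apply: measurable_funM; [exact: mg|exact: mh].
Qed.

Lemma measurable_sqrt D (f : R -> R) : measurable_fun D f ->
  measurable_fun D (fun t => Num.sqrt (f t)).
Proof.
move=> mf; apply: (measurableT_comp (f := @Num.sqrt R)) => //.
by apply: continuous_measurable_fun => x; exact: sqrt_continuous.
Qed.

Lemma mvec_enorm D g : mvec D g -> measurable_fun D (fun t => enorm (g t)).
Proof. by move=> mg; apply: measurable_sqrt; exact: mvec_dot3. Qed.

Lemma mvecS D g : measurable D -> mvec setT g -> mvec D g.
Proof. by move=> mD mg i; exact: measurable_funTS. Qed.

Lemma mvec_cst D (v : V3 R) : mvec D (fun=> v).
Proof. by move=> i; exact: measurable_cst. Qed.

Lemma lipschitz_vec_density q (L a b : R) : a < b ->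
  (forall s t, enorm (q s - q t) <= L * `|s - t|) ->
  exists g, [/\ mvec setT g,
    forall i c d, a <= c -> c <= d -> d <= b ->
      \int[mu]_(t in `[c, d]) g t ord0 i = q d ord0 i - q c ord0 i,
    forall i t, `|g t ord0 i| <= L &
    {ae mu, forall t, a < t < b -> derivable q t 1 /\ derive1 q t = g t}].
Proof.
move=> ab lq.
have lqi i : lip L (fun t => q t ord0 i).
  by move=> s t; have := le_trans (ler_coord_enorm _ i) (lq s t); rewrite !mxE.
have [g Hg] := choice (fun i => lip_density (lqi i) ab).
exists (fun t => \row_i g i t); split.
- move=> i; have [mg _ _ _] := Hg i.
  by under eq_fun do rewrite mxE.
- move=> i c d ac cd db; have [_ _ ig _] := Hg i.
  by under eq_Rintegral do rewrite mxE; exact: ig.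
- by move=> i t; rewrite mxE; have [_ bg _ _] := Hg i; exact: bg.
(* The coordinates are indexed by [nat] through [inord], so that the exceptional null sets can be
   united by [ae_foralln]. *)
- have : {ae mu, forall t, forall n, a < t < b ->
      is_derive t 1 (fun t => q t ord0 (inord n)) (g (inord n) t)}.
    by apply: ae_foralln => n; have [_ _ _] := Hg (inord n).
  apply: ae_imp => t dq tab.
  have dqi i : is_derive t 1 (fun t => q t ord0 i) (g i t).
    by have := dq (nat_of_ord i) tab; rewrite inord_val.
  have dqt : derivable q t 1.
    by apply/derivable_mxP => k i; rewrite (ord1 k); exact: ex_derive.
  split => //; rewrite derive1E derive_mx//; apply/rowP => i; rewrite !mxE.
  exact: derive_val.
Qed.

Lemma inK_density T q (a b : R) : a < b -> inK T q ->
  exists g, [/\ mvec setT g, forall t, enorm (g t) <= 1,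
    forall i c d, a <= c -> c <= d -> d <= b ->
      \int[mu]_(t in `[c, d]) g t ord0 i = q d ord0 i - q c ord0 i &
    {ae mu, forall t, a < t < b -> derivable q t 1 /\ derive1 q t = g t}].
Proof.
move=> ab [[[L lq] _] q1].
have [g [mg ig bg dg]] := lipschitz_vec_density ab lq.
(* The coordinatewise bounds by [L] do not give [enorm (g t) <= 1]. The density is set to 0 where
   this fails; on []a, b[] that happens only on a null set, since there [g] is almost everywhere the
   derivative bounded by [inK]. *)
pose g' t := if enorm (g t) <= 1 then g t else 0.
have aeg : {ae mu, forall t, a < t < b -> g' t = g t /\ derivable q t 1 /\ derive1 q t = g t}.
  by apply: ae_imp2 dg q1 => t H qt tab; have [dq dqE] := H tab; split=> //; rewrite /g' -dqE qt.
have mg' : mvec setT g'.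
  move=> i; rewrite [X in measurable_fun _ X](_ : _ =
     fun t => if enorm (g t) <= 1 then g t ord0 i else 0); last first.
    by apply/funext => t; rewrite /g'; case: ifPn => //; rewrite mxE.
  apply: measurable_fun_ifT => //.
  by apply: measurable_fun_ler => //; exact: mvec_enorm.
exists g'; split => //.
- by move=> t; rewrite /g'; case: ifPn => //; rewrite enorm0.
- move=> i c d ac cd db; rewrite -ig//; congr fine; apply: ae_eq_integral => //.
  + by apply/measurable_EFinP; exact: (mvecS _ mg').
  + by apply/measurable_EFinP; exact: (mvecS _ mg).
  + have naeb : {ae mu, forall t, t != a /\ t != b}.
      by apply: ae_imp2 (ae_neq a) (ae_neq b) => t.
    apply: ae_imp2 aeg naeb => t H [ta tb]; rewrite /= in_itv/= => /andP[ct td].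
    have /H[-> //] : a < t < b.
    by rewrite !lt_neqAle eq_sym ta tb (le_trans ac ct) (le_trans td db).
- by apply: ae_imp aeg => t /[apply] -[->].
Qed.

Lemma Rintegral_dot3 g (q : R -> V3 R) (c d M : R) (w : V3 R) : mvec setT g ->
  (forall t, enorm (g t) <= M) ->
  (forall i, \int[mu]_(t in `[c, d]) g t ord0 i = q d ord0 i - q c ord0 i) ->
  \int[mu]_(t in `[c, d]) dot3 w (g t) = dot3 w (q d - q c).
Proof.
move=> mg gM ig; under eq_Rintegral do rewrite dot3E.
have int1 i : mu.-integrable `[c, d] (EFin \o fun t => g t ord0 i).
  apply: (@bounded_integrable_itv _ _ _ c d _ M) => //; first exact: measurable_funTS.
  by move=> t _; exact: le_trans (ler_coord_enorm _ _) (gM t).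
have int2 i : mu.-integrable `[c, d] (EFin \o fun t => w ord0 i * g t ord0 i).
  apply: (@bounded_integrable_itv _ _ _ c d _ (`|w ord0 i| * M)) => //.
    by apply: measurable_funM => //; exact: measurable_funTS.
  move=> t _; rewrite normrM ler_wpM2l//.
  exact: le_trans (ler_coord_enorm _ _) (gM t).
have int3 : mu.-integrable `[c, d] (EFin \o fun t => w ord0 ord0 * g t ord0 ord0 + w ord0 1 * g t ord0 1).
  have := integrableD _ (int2 ord0) (int2 1); apply => //.
by rewrite RintegralD// RintegralD// !RintegralZl// !ig dot3E !mxE.
Qed.

(** Integrating [dot3 w (g x)] with [w = q t - q s] yields [|w|^2 <= |w| * (t - s)], so that only
    scalar integrals have to be estimated. *)
Lemma inK_lip T q : inK T q -> forall s t, enorm (q s - q t) <= `|s - t|.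
Proof.
move=> Kq.
suff H s t : s < t -> enorm (q t - q s) <= t - s.
  move=> s t; case: (ltgtP s t) => st.
  - by rewrite enormB distrC ger0_norm ?subr_ge0 ?H// ltW.
  - by rewrite ger0_norm ?subr_ge0 ?H// ltW.
  - by rewrite st !subrr normr0 enorm0.
move=> st.
have [g [mg g1 ig dg]] := inK_density st Kq.
have := @Rintegral_dot3 g q s t 1 (q t - q s) mg g1 (fun i => ig i s t (lexx _) (ltW st) (lexx _)).
set w := q t - q s => E.
have [->|w0] := eqVneq (enorm w) 0; first by rewrite subr_ge0 ltW.
have wgt0 : 0 < enorm w by rewrite lt_neqAle eq_sym w0 enorm_ge0.
rewrite -(ler_pM2l wgt0) -expr2 enorm_sqr -E -(Rintegral_cst_itv true false _ (ltW st)).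
apply: le_Rintegral => //.
- apply: (@bounded_integrable_itv _ _ _ s t _ (enorm w)) => //.
    by apply: mvec_dot3; [exact: mvec_cst|exact: mvecS].
  move=> x _; apply: (le_trans (ler_dot3 _ _)).
  by rewrite ler_piMr// enorm_ge0.
- by apply: (@bounded_integrable_itv _ _ _ s t _ (`|enorm w|)).
- move=> x _; apply: (le_trans (ler_norm _)); apply: (le_trans (ler_dot3 _ _)).
  by rewrite ler_piMr// enorm_ge0.
Qed.

Lemma lip_enorm_derive q t : (forall s t, enorm (q s - q t) <= `|s - t|) ->
  derivable q t 1 -> enorm (derive1 q t) <= 1.
Proof.
move=> lq dq; rewrite derive1E.
have : h^-1 *: (q (h *: 1 + t) - q t) @[h --> 0^'] --> 'D_1 q t by exact: dq.
move=> /cvg_enormP/cvgr0Pnorm_le dq2; apply/ler_addgt0Pr => e /dq2 {}dq2.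
near (0:R)^' => h.
apply: (le_trans (ler_enorm_sub _ (h^-1 *: (q (h *: 1 + t) - q t)))).
rewrite addrC lerD//.
  rewrite enormZ normfV ler_pdivrMl ?normr_gt0.
    by apply: (le_trans (lq _ _)); rewrite addrK [h *: 1]mulr1 mulr1.
  by near: h; exact: nbhs_dnbhs_neq.
by rewrite enormB -[leLHS]ger0_norm ?enorm_ge0//; near: h.
Unshelve. all: by end_near. Qed.

Lemma lip_inK T q : (forall s t, enorm (q s - q t) <= `|s - t|) ->
  (forall t, q (t + T) = q t) -> inK T q.
Proof.
move=> lq pq; split.
  by split => //; exists 1 => s t; rewrite mul1r.
(* Densities are available on bounded intervals only, so the line is exhausted by the intervals []-
   n, n[]; the one for [n = 0] is empty and is treated apart. *)
have : {ae mu, forall t, forall n : nat, - n%:R < t < n%:R -> enorm (derive1 q t) <= 1}.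
  apply: ae_foralln => -[|n].
    by apply: aeW => t /andP[/lt_trans h /h]; rewrite oppr0 ltxx.
  have nn : - n.+1%:R < n.+1%:R :> R by have : 0 < n.+1%:R :> R; [rewrite ltr0n|move: (n.+1%:R : R) => z; lra].
  have [s t|g [_ _ _]] := @lipschitz_vec_density q 1 _ _ nn; first by rewrite mul1r.
  apply: ae_imp => t /[apply] -[dq _].
  exact: lip_enorm_derive.
apply: ae_imp => t /(_ (Num.bound `|t|)); apply.
by rewrite -ltr_norml archi_boundP.
Qed.

End velocity.

(** * Increments of functions controlled by their partial derivatives *)

Section increments.
Variable R : realType.
Implicit Types (x y z : V3 R).

Lemma derive_bound_incr (f : R -> R) (a b C : R) : a <= b ->
  (forall s, a <= s <= b -> derivable f s 1 /\ `|derive1 f s| <= C) ->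
  `|f b - f a| <= C * (b - a).
Proof.
move=> ab df.
have [c /[!in_itv]/= cab ->] : exists2 c, c \in `[a, b] & f b - f a = derive1 f c * (b - a).
  apply: MVT_segment => //.
    move=> s; rewrite in_itv/= => /andP[sa sb].
    have [] := df s; first by rewrite !ltW.
    by move=> dfs _; rewrite derive1E; exact: DeriveDef.
  apply: derivable_within_continuous => s; rewrite in_itv/= => sab.
  by have [] := df s.
by rewrite normrM (ger0_norm (_ : 0 <= b - a)) ?subr_ge0// ler_wpM2r ?subr_ge0//; case: (df c).
Qed.

(** [dx] differentiates at parameter 0 along a line through the point itself, whereas the mean value
    theorem differentiates at parameter [s] along one fixed line; the two difference quotients
    coincide. *)
Lemma partial_shift (W : normedModType R) (f : V3 R -> W) z (e : V3 R) (s : R) :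
  derivable (fun u : R => f (z + s *: e + u *: e)) 0 1 ->
  derivable (fun u : R => f (z + u *: e)) s 1 /\
  derive1 (fun u : R => f (z + u *: e)) s = derive1 (fun u : R => f (z + s *: e + u *: e)) 0.
Proof.
have E : (fun h : R => h^-1 *: (f (z + s *: e + (h *: 1 + 0) *: e) - f (z + s *: e + 0 *: e))) =
         (fun h : R => h^-1 *: (f (z + (h *: 1 + s) *: e) - f (z + s *: e))).
  apply/funext => h; rewrite scale0r !addr0; congr (_ *: (f _ - _)).
  by rewrite scalerDl -addrA (addrC (s *: e)).
by rewrite /derivable !derive1E /derive /= E.
Qed.

Lemma coord_incr (f : V3 R -> R) z (i : 'I_3) (d C : R) :
  (forall s, `|s| <= `|d| ->
     derivable (fun u : R => f (z + s *: evec R i + u *: evec R i)) 0 1 /\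
     `|derive1 (fun u : R => f (z + s *: evec R i + u *: evec R i)) 0| <= C) ->
  `|f (z + d *: evec R i) - f z| <= C * `|d|.
Proof.
move=> df.
have [d0|/ltW d0] := leP 0 d.
- have := @derive_bound_incr (fun u : R => f (z + u *: evec R i)) 0 d C d0.
  rewrite scale0r addr0 subr0 (ger0_norm d0); apply => s /andP[s0 sd].
  have [|df1 df2] := df s; first by rewrite !ger0_norm.
  by have [? ->] := partial_shift df1.
- have := @derive_bound_incr (fun u : R => f (z + u *: evec R i)) d 0 C d0.
  rewrite scale0r addr0 sub0r (ler0_norm d0) distrC; apply => s /andP[sd s0].
  have [|df1 df2] := df s; first by rewrite !ler0_norm// lerN2.
  by have [? ->] := partial_shift df1.
Qed.

Lemma ord3P (P : 'I_3 -> Prop) : P ord0 -> P 1 -> P 2%:R -> forall j, P j.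
Proof.
move=> P0 P1 P2 [[|[|[|//]]] h].
- by rewrite (_ : Ordinal h = ord0)//; exact: val_inj.
- by rewrite (_ : Ordinal h = 1)//; exact: val_inj.
- by rewrite (_ : Ordinal h = 2%:R)//; exact: val_inj.
Qed.

Lemma sum3E (f : 'I_3 -> R) : \sum_i f i = f ord0 + f 1 + f 2%:R.
Proof.
rewrite !big_ord_recl big_ord0 addr0 addrA.
by congr (_ + f _ + f _); exact: val_inj.
Qed.

(** The path from [x] to [y] moves along one axis at a time, so each leg is governed by a single
    partial derivative. The box is centred at [x], which avoids distinguishing the signs of the
    coordinate increments. *)
Lemma box_incr (f : V3 R -> R) x y (C : R) :
  (forall z, (forall i, `|z ord0 i - x ord0 i| <= `|y ord0 i - x ord0 i|) ->
    forall i, derivable (fun s : R => f (z + s *: evec R i)) 0 1 /\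
      `|derive1 (fun s : R => f (z + s *: evec R i)) 0| <= C) ->
  `|f y - f x| <= C * \sum_i `|y ord0 i - x ord0 i|.
Proof.
move=> df; pose d i := y ord0 i - x ord0 i.
pose z1 := x + d ord0 *: evec R ord0.
pose z2 := z1 + d 1 *: evec R 1.
have yE : y = z2 + d 2%:R *: evec R 2%:R.
  apply/rowP; apply: ord3P; rewrite /z2 /z1 /d !mxE/= ?mulr1 ?mulr0 ?addr0; ring.
have s1 : `|f z1 - f x| <= C * `|d ord0|.
  apply: coord_incr => s sd; apply: df; apply: ord3P; rewrite !mxE/= ?mulr1 ?mulr0 addrAC subrr add0r ?normr0//.
have s2 : `|f z2 - f z1| <= C * `|d 1|.
  apply: coord_incr => s sd; apply: df; apply: ord3P; rewrite /z2 /z1 !mxE/= ?mulr1 ?mulr0 ?addr0; do ?[by rewrite subrr normr0]; rewrite addrAC subrr add0r ?normr0//.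
have s3 : `|f y - f z2| <= C * `|d 2%:R|.
  rewrite {1}yE; apply: coord_incr => s sd; apply: df; apply: ord3P; rewrite /z2 /z1 !mxE/= ?mulr1 ?mulr0 ?addr0; do ?[by rewrite subrr normr0]; rewrite addrAC subrr add0r ?normr0//.
rewrite sum3E -/(d ord0) -/(d 1) -/(d 2%:R).
have -> : f y - f x = (f y - f z2) + (f z2 - f z1) + (f z1 - f x) by ring.
have n1 := ler_normD (f y - f z2 + (f z2 - f z1)) (f z1 - f x).
have n2 := ler_normD (f y - f z2) (f z2 - f z1).
by apply: (le_trans n1); rewrite !mulrDr [leRHS]addrC [leRHS]addrA (le_trans (lerD (le_trans n2 (lerD s3 s2)) s1))// -!addrA (addrC (C * `|d 1|)).
Qed.


Lemma sum_coord_le x : \sum_i `|x ord0 i| <= 3 * enorm x.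
Proof.
rewrite sum3E; have := ler_coord_enorm x ord0; have := ler_coord_enorm x 1.
by have := ler_coord_enorm x 2%:R; lra.
Qed.

Lemma enorm_row_coords (x : V3 R) (c : R) : (forall i, `|x ord0 i| <= c) -> enorm x <= 3 * c.
Proof.
move=> xc; apply: (le_trans (ler_enorm_sum x)); rewrite sum3E.
by have := xc ord0; have := xc 1; have := xc 2%:R; lra.
Qed.

Definition in_box x y z := forall i, `|z ord0 i - x ord0 i| <= `|y ord0 i - x ord0 i|.

Lemma in_box_enorm x y z : in_box x y z -> enorm (z - x) <= enorm (y - x).
Proof.
move=> zb; rewrite /enorm ler_sqrt ?dot3_ge0//; apply: ler_sum => i _.
rewrite -!expr2 !mxE -[leLHS]real_normK ?num_real// -[leRHS]real_normK ?num_real//.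
by rewrite ler_sqr ?nnegrE//; exact: zb.
Qed.

Variable A : R -> V3 R -> V3 R.
Hypothesis A1 : C1_R4 A.

Let derive1_coord (f : R -> V3 R) t i : derivable f t 1 ->
  derivable (fun s => f s ord0 i) t 1 /\
  derive1 (fun s => f s ord0 i) t = derive1 f t ord0 i.
Proof.
move=> df; split; first by move/derivable_mxP : df => /(_ ord0 i).
by rewrite !derive1E derive_mx// mxE.
Qed.

(** The mean value theorem is applied to each coordinate of [A], first in time at fixed [x], then in
    space at fixed [t]. One factor 3 comes from the sum of coordinate increments in [box_incr], the
    other from reassembling the vector. Derivatives are bounded only where the path can go, so that
    the same estimate serves globally and far away. *)
Lemma C1_incr (s t C : R) x y :
  (forall tau z, Num.min s t <= tau <= Num.max s t -> in_box x y z ->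
    enorm (dt A tau z) <= C /\ forall i, enorm (dx A i tau z) <= C) ->
  enorm (A t y - A s x) <= 9 * C * (`|t - s| + enorm (y - x)).
Proof.
move=> AC; have [At [Ax _]] := A1.
have C0 : 0 <= C.
  have [|i|h _] := AC s x; first by rewrite ge_min le_max lexx.
    by rewrite subrr normr0.
  exact: le_trans (enorm_ge0 _) h.
have step i : `|(A t y - A s x) ord0 i| <= C * `|t - s| + C * (3 * enorm (y - x)).
  rewrite !mxE.
  have -> : A t y ord0 i - A s x ord0 i = (A t x ord0 i - A s x ord0 i) + (A t y ord0 i - A t x ord0 i) by ring.
  apply: (le_trans (ler_normD _ _)); apply: lerD.
    wlog : s t AC / s <= t.
      move=> H; have [/H|/ltW/H] := leP s t; first exact.
      by rewrite distrC (distrC t); apply => tau z; rewrite minC maxC; exact: AC.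
    move=> st; rewrite (ger0_norm (_ : 0 <= t - s)) ?subr_ge0//.
    apply: (derive_bound_incr (f := fun u => A u x ord0 i)) => // u ust.
    have [d1 ->] := derive1_coord i (At u x); split => //.
    apply: le_trans (ler_coord_enorm _ _) _.
    have [|j|] := AC u x; first by rewrite min_l ?max_r.
      by rewrite subrr normr0.
    by [].
  apply: (le_trans (box_incr (f := fun z => A t z ord0 i) (C := C) _)); last first.
    rewrite ler_wpM2l//; apply: le_trans (sum_coord_le (y - x)).
    by apply: ler_sum => k _; rewrite !mxE.
  move=> z zb k.
  have [d1 ->] := derive1_coord i (Ax t z k); split => //.
  apply: le_trans (ler_coord_enorm _ _) _.
  have tin : Num.min s t <= t <= Num.max s t by rewrite ge_min le_max lexx !orbT.
  by have [_] := AC t z tin zb; exact.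
apply: (le_trans (enorm_row_coords step)).
have := enorm_ge0 (y - x); have := normr_ge0 (t - s).
move: `|t - s| (enorm (y - x)) => u v *; nra.
Qed.

Lemma jacnorm_ge (t : R) x i : enorm (dx A i t x) <= jacnorm A t x.
Proof.
rewrite /jacnorm -[leLHS]ger0_norm ?enorm_ge0// -sqrtr_sqr ler_sqrt; last first.
  by apply: sumr_ge0 => j _; rewrite sqr_ge0.
by rewrite (bigD1 i)//= lerDl sumr_ge0// => j _; rewrite sqr_ge0.
Qed.

Lemma compact_cube (M : R) : compact [set x : 'rV[R]_3 | forall i, `[-M, M]%classic (x ord0 i)].
Proof.
exact: (@rV_compact R 3 (fun=> `[-M, M]%classic) (fun i => @segment_compact R (-M) M)).
Qed.

Lemma C1_bounded_cube (T M : R) (B : R -> V3 R -> V3 R) :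
  continuous (fun p : R * V3 R => B p.1 p.2) ->
  exists C : R, forall t x, 0 <= t <= T -> enorm x <= M -> enorm (B t x) <= C.
Proof.
move=> cB.
pose K : set (R * 'rV[R]_3) := `[0, T]%classic `*` [set x : 'rV[R]_3 | forall i, `[-M, M]%classic (x ord0 i)].
have cK : compact K by apply: compact_setX; [exact: segment_compact|exact: compact_cube].
have : compact ((fun p => enorm (B p.1 p.2)) @` K).
  apply: continuous_compact => //; apply: continuous_subspaceT => p.
  by apply: continuous_comp; [exact: cB|exact: enorm_continuous].
move=> /compact_bounded[C [_ HC]]; exists (C + 1) => t x t0T xM.
apply: le_trans (ler_norm _) _; apply: (HC (C + 1)); first by rewrite ltrDl.
exists (t, x) => //; split => /=; first by rewrite in_itv.
by move=> i; rewrite in_itv/= -ler_norml; exact: le_trans (ler_coord_enorm _ _) xM.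
Qed.

End increments.

(** * Lipschitz estimates for the vector potential *)

Section magnetic.
Variables (R : realType) (T : R) (A : R -> V3 R -> V3 R).
Hypothesis hA : classA T A.

(** Outside a large ball the decay condition bounds the derivatives by 1; inside, with times in
    [[0, T]], compactness bounds them. *)
Lemma classA_lip : exists C : R, 0 <= C /\ forall s t x y, 0 <= s <= T -> 0 <= t <= T ->
  enorm (A t y - A s x) <= C * (`|t - s| + enorm (y - x)).
Proof.
have [A1 [_ [_ Ainf]]] := hA; have [_ [_ [cAt cAx]]] := A1.
have [M HM] := Ainf 1 ltr01.
have [C0 H0] := C1_bounded_cube T M cAt.
have [Ci Hi] := choice (fun i => C1_bounded_cube T M (cAx i)).
pose C := 1 + `|C0| + \sum_i `|Ci i|.
have C1 : 1 <= C by rewrite /C -addrA lerDl addr_ge0// sumr_ge0.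
exists (9 * C); split; first by lra.
move=> s t x y s0 t0; apply: C1_incr => // tau z tauT _.
have {}tauT : 0 <= tau <= T.
  case/andP: s0 => ? ?; case/andP: t0 => ? ?; case/andP: tauT => h1 h2.
  rewrite (le_trans _ h1) ?(le_trans h2) ?ge_max ?le_min; [by []|exact/andP|exact/andP].
have [zM|zM] := leP (enorm z) M.
  split.
    apply: (le_trans (H0 _ _ tauT zM)); apply: (le_trans (ler_norm _)).
    by rewrite /C addrAC lerDr addr_ge0// sumr_ge0.
  move=> i; apply: (le_trans (Hi i _ _ tauT zM)); apply: (le_trans (ler_norm _)).
  by rewrite /C (bigD1 i)//= addrCA lerDl !addr_ge0// sumr_ge0.
have := HM tau z zM; have := enorm_ge0 (dt A tau z).
have := fun i => jacnorm_ge A tau z i; have : 0 <= jacnorm A tau z by exact: sqrtr_ge0.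
move=> h1 h2 h3 h4; split; first lra.
by move=> i; apply: (le_trans (h2 i)); lra.
Qed.

(** The condition on [M] keeps the whole box around [x] outside the ball of radius [M]. Times are
    unrestricted because the decay is uniform in [t]. *)
Lemma classA_far (e : R) : 0 < e -> exists M : R, forall s t x y, M < enorm x - enorm (y - x) ->
  enorm (A t y - A s x) <= e * (`|t - s| + enorm (y - x)).
Proof.
move=> e0; have [A1 [_ [_ Ainf]]] := hA.
have e9 : 0 < e / 9 by rewrite divr_gt0.
have [M HM] := Ainf _ e9; exists M => s t x y xM.
have -> : e = 9 * (e / 9) by field.
apply: C1_incr => // tau z _ /in_box_enorm zb.
have {}xM : M < enorm z.
  by have := ler_enorm_sub x z; rewrite enormB; lra.
have := HM tau z xM; have := enorm_ge0 (dt A tau z).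
have := fun i => jacnorm_ge A tau z i; have : 0 <= jacnorm A tau z by exact: sqrtr_ge0.
move=> h1 h2 h3 h4; split; first lra.
by move=> i; apply: (le_trans (h2 i)); lra.
Qed.

End magnetic.

(** * Regularity and decay of the scalar potential *)

Section electric.
Variables (R : realType) (T : R) (S : set (V3 R)) (Phi : R -> V3 R -> R).
Hypothesis cS : closed (S : set 'rV[R]_3).
Hypothesis hP : classP T S Phi.

(** The partial derivatives are continuous at [x], hence bounded by some [C] on a ball around [x]
    that avoids [S]; [box_incr] then gives a Lipschitz estimate at [x]. *)
Lemma classP_continuous (t : R) (x : 'rV[R]_3) : ~ S x -> Phi t y @[y --> x] --> Phi t x.
Proof.
have [_ [_ [_ [dP [cdP _]]]]] := hP.
move=> Sx.
have oS : open (~` S : set 'rV[R]_3) by exact: closed_openC.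
have cP i : {for x, continuous (dx Phi i t : 'rV[R]_3 -> R)}.
  have := cdP t i; rewrite continuous_open_subspace// => /(_ x); apply.
  by rewrite inE.
pose C := \sum_i (`|dx Phi i t x| + 1).
have C0 : 0 <= C by apply: sumr_ge0 => i _; rewrite addr_ge0.
have : \forall y \near x, ~ S y /\ forall i, `|dx Phi i t y| <= C.
  near=> y; split.
    by near: y; exact: open_nbhs_nbhs.
  move=> i; move: i; near: y; apply: filter_forall => i.
  have /cvgrPdist_le/(_ 1 ltr01) := cP i; apply: filterS => y h.
  apply: (@le_trans _ _ (`|dx Phi i t x| + 1)).
    have := ler_normB (dx Phi i t x) (dx Phi i t x - dx Phi i t y).
    by rewrite opprB addrC subrK; lra.
  by rewrite /C (bigD1 i)//= lerDl sumr_ge0// => j _; rewrite addr_ge0.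
move=> /nbhs_ballP[r r0 Hr].
apply/(@cvgrPdist_le _ _ _ _ (nbhs_filter x)) => e e0.
near=> y.
rewrite distrC; apply: (@le_trans _ _ (C * \sum_i `|y ord0 i - x ord0 i|)).
  apply: box_incr => z zb i.
  have [Sz Cz] : ~ S z /\ forall i, `|dx Phi i t z| <= C.
    apply: Hr; rewrite -ball_normE /=.
    apply: (@le_lt_trans _ _ `|x - y|); last first.
      by near: y; apply: (cvgrPdist_lt _ _).1 => //; exact: cvg_id.
    rewrite [leLHS]/Num.Def.normr/= mx_normrE; apply: bigmax_le => // -[k j] _ /=.
    rewrite (ord1 k) !mxE distrC; apply: (le_trans (zb j)); rewrite distrC.
    by have := ler_coord_norm (x - y) j; rewrite !mxE.
  by split; [exact: dP|exact: Cz].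
apply: (@le_trans _ _ (C * (3 * enorm (y - x)))).
  rewrite ler_wpM2l//; apply: le_trans (sum_coord_le _).
  by apply: ler_sum => i _; rewrite !mxE.
apply: (@le_trans _ _ (C * (3 * (3 * `|x - y|)))).
  by rewrite distrC !ler_wpM2l// ler_enorm_norm.
have C1 : 0 < C + 1 by lra.
apply: (@le_trans _ _ ((C + 1) * 9 * `|x - y|)).
  by have := normr_ge0 (x - y); move: (`|x - y|) => u *; nra.
rewrite -ler_pdivlMl; last by lra.
near: y; apply: (cvgrPdist_le _ _).1; first exact: cvg_id.
by rewrite mulr_gt0 ?invr_gt0; lra.
Unshelve. all: by end_near. Qed.

Lemma classP_far (e : R) : 0 < e -> compact (S : set 'rV[R]_3) ->
  exists M : R, forall t x y, M < enorm x - enorm (y - x) ->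
  ~ S x /\ `|Phi t y - Phi t x| <= e * enorm (y - x).
Proof.
move=> e0 /(@compact_bounded _ ('rV[R]_3))[B [_ HB]].
have [_ [_ [_ [dP [_ [Pinf _]]]]]] := hP.
have e3 : 0 < e / 3 by rewrite divr_gt0.
have [M HM] := Pinf _ e3.
(* [B + 1] is used because [compact_bounded] provides every bound strictly above [B]; the factor 3
   converts the maximum norm into the Euclidean one. Points of larger norm lie outside [S]. *)
have SB x : S x -> enorm x <= 3 * (B + 1).
  move=> Sx; apply: (le_trans (ler_enorm_norm _)); rewrite ler_wpM2l//.
  by apply: HB => //; rewrite ltrDl.
exists (Num.max M (3 * (B + 1))) => t x y; rewrite gt_max => /andP[xM xB].
split.
  by move=> /SB; have := enorm_ge0 (y - x); lra.
apply: (@le_trans _ _ (e / 3 * \sum_i `|y ord0 i - x ord0 i|)).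
  apply: box_incr => z /in_box_enorm zb i.
  have xz : enorm x - enorm (y - x) <= enorm z.
    by have := ler_enorm_sub x z; rewrite enormB; lra.
  have Sz : ~ S z by move=> /SB; lra.
  split; first exact: dP.
  have := ltW (HM t z Sz (lt_le_trans xM xz)); apply: le_trans.
  by have := ler_coord_enorm (gradx Phi t z) i; rewrite mxE.
have -> : e * enorm (y - x) = e / 3 * (3 * enorm (y - x)) by field.
rewrite ler_wpM2l ?divr_ge0 ?(ltW e0)//; apply: le_trans (sum_coord_le _).
by apply: ler_sum => i _; rewrite !mxE.
Qed.
End electric.

(** * Integrals of possibly nonmeasurable or nonintegrable functions *)

(* [derive1 q] takes a junk value where [q] is not differentiable and
   [lebesgue_measure] is not complete, so the integrands of the action need not
   be measurable; the library then computes lower integrals. *)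
Section nonmeasurable_integral.
Context d (T : measurableType d) (R : realType) (mu : {measure set T -> \bar R}).
Local Open Scope ereal_scope.
Implicit Types f g : T -> \bar R.

Lemma ge0_le_lower_integral f g : (forall x, 0 <= f x) -> (forall x, f x <= g x) ->
  \int[mu]_x f x <= \int[mu]_x g x.
Proof.
move=> f0 fg; have g0 x : 0 <= g x by exact: le_trans (f0 x) (fg x).
rewrite !ge0_integralTE//; apply: le_ereal_sup => _ [h hf <-]; exists h => // x.
exact: le_trans (hf x) (fg x).
Qed.

(** [f] is squeezed between two measurable functions that agree with [g] off a null set [N] and
    equal 0, respectively [+oo], on [N]; both have the integral of [g]. *)
Lemma ge0_ae_eq_lower_integral f g : (forall x, 0 <= f x) -> (forall x, 0 <= g x) ->
  measurable_fun setT g -> {ae mu, forall x, f x = g x} ->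
  \int[mu]_x f x = \int[mu]_x g x.
Proof.
move=> f0 g0 mg [N [mN N0 fgN]].
have fg x : ~ N x -> f x = g x by apply: contra_notP => fgx; exact: fgN.
have mNb : measurable_fun setT (fun x => x \in N).
  by apply: (measurable_fun_bool true); rewrite setTI preimage_mem_true.
have aeN (h : T -> \bar R) : (forall x, ~ N x -> h x = g x) -> ae_eq mu setT h g.
  move=> hg; exists N; split => // x /=; apply: contra_notP => Nx _; exact: hg.
apply/eqP; rewrite eq_le; apply/andP; split.
- apply: (@le_trans _ _ (\int[mu]_x (if x \in N then +oo else g x))).
    apply: ge0_le_lower_integral => // x; case: ifPn => [_|]; first exact: leey.
    by rewrite notin_setE => /fg ->.
  rewrite (ae_eq_integral g)//; first exact: measurable_fun_ifT.
  by apply: aeN => x Nx; rewrite memNset.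
- apply: (@le_trans _ _ (\int[mu]_x (if x \in N then 0 else g x))).
    rewrite (ae_eq_integral g (fun x => if x \in N then 0 else g x))//; first exact: measurable_fun_ifT.
    by apply: aeN => x Nx; rewrite memNset.
  apply: ge0_le_lower_integral => x; first by case: ifPn.
  by case: ifPn => // ; rewrite notin_setE => /fg ->.
Qed.

Lemma ae_eq_lower_integral (D : set T) f g : measurable D -> measurable_fun D g ->
  {ae mu, forall x, D x -> f x = g x} ->
  \int[mu]_(x in D) f x = \int[mu]_(x in D) g x.
Proof.
move=> mD mg fg; rewrite integral_mkcond [RHS]integral_mkcond.
have mg' : measurable_fun setT (g \_ D) by apply/(measurable_restrictT _ mD).
have fg' : {ae mu, forall x, (f \_ D) x = (g \_ D) x}.
  apply: filterS fg => x.
  by rewrite !patchE; case: ifPn => //; rewrite inE => Dx; exact.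
rewrite integralE [RHS]integralE; congr (_ - _).
- apply: ge0_ae_eq_lower_integral => //; first exact: measurable_funepos.
  apply: filterS fg' => x fgx.
  by rewrite !funeposE fgx.
- apply: ge0_ae_eq_lower_integral => //; first exact: measurable_funeneg.
  apply: filterS fg' => x fgx.
  by rewrite !funenegE fgx.
Qed.

(** The case of interest is an infinite integral of [P]: the negative part of [u + P] is at most
    [|u|], while [P <= (u + P)^+ + |u|] forces the positive part to have infinite integral. *)
Lemma integral_bounded_add_ge0 (D : set T) (u : T -> R) (P : T -> R) : measurable D ->
  mu.-integrable D (EFin \o u) -> measurable_fun D P -> (forall x, D x -> (0 <= P x)%R) ->
  \int[mu]_(x in D) (u x + P x)%:E =
  \int[mu]_(x in D) (u x)%:E + \int[mu]_(x in D) (P x)%:E.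
Proof.
move=> mD iu mP P0.
have mu_ : measurable_fun D u by apply/measurable_EFinP; exact: measurable_int iu.
have [Poo|Poo] := ltP (\int[mu]_(x in D) (P x)%:E) +oo.
  have iP : mu.-integrable D (EFin \o P).
    apply/integrableP; split; first exact/measurable_EFinP.
    rewrite (eq_integral (EFin \o P))// => x; rewrite inE => Dx.
    by rewrite /= ger0_norm// P0.
  by under eq_integral do rewrite EFinD; rewrite integralD.
have {}Poo : \int[mu]_(x in D) (P x)%:E = +oo by apply/eqP; rewrite -leye_eq.
have fu : \int[mu]_(x in D) (u x)%:E \is a fin_num by exact: integrable_fin_num.
rewrite Poo addey; last by rewrite -ltNye ltNye_eq fu.
rewrite integralE.
have neg_fin : \int[mu]_(x in D) (fun x => (u x + P x)%:E)^\- x < +oo.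
  have /integrableP[_ iu2] := iu.
  apply: le_lt_trans iu2; apply: ge0_le_integral => //.
  - by apply: measurable_funeneg; apply/measurable_EFinP; exact: measurable_funD.
  - by do 2 apply: measurableT_comp => //; exact/measurable_EFinP.
  - move=> x Dx; rewrite funenegE ge_max -EFinN !lee_fin/=.
    apply/andP; split; last by rewrite normr_ge0.
    by have := ler_norm (- u x)%R; rewrite normrN; have := P0 x Dx; lra.
suff pos_oo : \int[mu]_(x in D) (fun x => (u x + P x)%:E)^\+ x = +oo.
  rewrite pos_oo; move: neg_fin.
  by case: (\int[mu]_(x in D) _) => [r| |].
apply/eqP; rewrite -leye_eq -Poo.
have : \int[mu]_(x in D) (P x)%:E <= \int[mu]_(x in D) ((fun x => (u x + P x)%:E)^\+ x + `|u x|%:E).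
  apply: ge0_le_integral => //.
  - exact/measurable_EFinP.
  - apply: emeasurable_funD.
      by apply: measurable_funepos; apply/measurable_EFinP; exact: measurable_funD.
    by apply/measurable_EFinP; exact: measurableT_comp.
  - move=> x Dx; apply: (@le_trans _ _ ((u x + P x)%:E + `|u x|%:E)).
      by rewrite -EFinD lee_fin; have := ler_norm (- u x)%R; rewrite normrN; lra.
    by apply: leeD => //; rewrite funeposE le_max lexx.
rewrite ge0_integralD//; last 2 first.
  by apply: measurable_funepos; apply/measurable_EFinP; exact: measurable_funD.
  by apply/measurable_EFinP; exact: measurableT_comp.
have /integrableP[_] := iu; rewrite Poo /=.
move: (\int[mu]_(x in D) `|(u x)%:E|) => v vfin.
by case: (\int[mu]_(x in D) _) v vfin => [r| |] [v| |].
Qed.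
End nonmeasurable_integral.

(** * Uniform grids and step functions on them *)

Section grid.
Variable R : realType.
Local Notation mu := (@lebesgue_measure R).
Implicit Types (h t : R).

(* Meaningful for [0 <= t] only: [Num.truncn] is 0 on negative numbers. *)
Definition gidx h t : nat := Num.truncn (t / h).
Definition grid h t : R := h * (gidx h t)%:R.

Lemma gidx_eq h t n : 0 < h -> h * n%:R <= t < h * n.+1%:R -> gidx h t = n.
Proof.
move=> h0 tn; apply: truncn_def.
by rewrite ler_pdivlMr// ltr_pdivrMr// ![_ * h]mulrC.
Qed.

Lemma grid_itv h t : 0 < h -> 0 <= t -> grid h t <= t < grid h t + h.
Proof.
move=> h0 t0; rewrite /grid /gidx.
set K := Num.truncn _; have -> : h * K%:R + h = h * K.+1%:R by rewrite -natr1 mulrDr mulr1.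
rewrite /K.
have : 0 <= t / h by rewrite divr_ge0// ltW.
by move=> /truncn_itv; rewrite ler_pdivlMr// ltr_pdivrMr// ![_ * h]mulrC.
Qed.

Lemma grid_ge0 h t : 0 < h -> 0 <= grid h t.
Proof. by move=> h0; rewrite mulr_ge0// ltW. Qed.

(** The preimage is cut along the countably many cells [[h * n, h * (n + 1)[], on each of which the
    index is the constant [n]. *)
Lemma measurable_gidx_comp (T h : R) (F : nat -> R -> R) : 0 < h ->
  (forall n, measurable_fun `[0, T] (F n)) ->
  measurable_fun `[0, T] (fun t => F (gidx h t) t).
Proof.
move=> h0 mF mD B mB.
rewrite (_ : _ `&` _ = \bigcup_n (([set` `[0, T]] `&` F n @^-1` B) `&` [set` `[h * n%:R, h * n.+1%:R[])).
  by apply: bigcupT_measurable => n; apply: measurableI => //; exact: mF.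
apply/seteqP; split => t /=.
  move=> [t0T Bt]; exists (gidx h t) => //; split => //=.
  rewrite in_itv/= -natr1 mulrDr mulr1; apply: grid_itv => //.
  by move: t0T; rewrite in_itv => /andP[].
move=> [n _ [[t0T Bt]]]; rewrite /= in_itv/= => /(gidx_eq h0) tn.
by split => //; rewrite tn.
Qed.

Lemma Rintegral_grid (f : R -> R) h (n : nat) (M : R) : 0 < h ->
  measurable_fun `[0, h * n%:R] f -> (forall t, 0 <= t <= h * n%:R -> `|f t| <= M) ->
  \int[mu]_(t in `[0, h * n%:R]) f t =
  \sum_(k < n) \int[mu]_(t in `[h * k%:R, h * k.+1%:R]) f t.
Proof.
move=> h0; elim: n => [|n IH] mf fM.
  by rewrite big_ord0 mulr0 set_itv1 Rintegral_set1.
have hn : h * n%:R <= h * n.+1%:R by rewrite ler_pM2l// ler_nat.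
have hn0 : 0 <= h * n%:R by rewrite mulr_ge0// ltW.
rewrite big_ord_recr /= -IH; last 2 first.
- by apply: measurable_funS mf => //; apply: subset_itvl; rewrite bnd_simp.
- by move=> t /andP[t0 tn]; apply: fM; rewrite t0 (le_trans tn).
have iF : mu.-integrable `[0, h * n.+1%:R] (EFin \o f).
  by apply: (@bounded_integrable_itv _ _ _ 0 (h * n.+1%:R) _ M) => // t; rewrite /= in_itv; exact: fM.
rewrite -(@Rintegral_itv_obnd_cbnd _ (h * n%:R) (BRight (h * n.+1%:R)) f); last first.
  by apply: integrableS iF => //; apply: subset_itvr; rewrite bnd_simp.
by rewrite -(@Rintegral_itvB _ f (BLeft 0) (BRight (h * n.+1%:R)) (h * n%:R))// ?bnd_simp// addrC subrK.
Qed.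

Lemma cvg_step (T : R) : (fun n => T / n.+1%:R) @ \oo --> (0 : R).
Proof. by rewrite -[X in _ --> X](mulr0 T); apply: cvgM; [exact: cvg_cst|exact: cvg_harmonic]. Qed.

Lemma cvg_grid (h : nat -> R) t : (forall n, 0 < h n) -> h @ \oo --> (0 : R) -> 0 <= t ->
  grid (h n) t @[n --> \oo] --> t.
Proof.
move=> h0 hh t0; apply: (@squeeze_cvgr _ _ _ _ (fun n => t - h n) (cst t)).
- near=> n; have /andP[g1 g2] := grid_itv (h0 n) t0.
  by rewrite /cst g1 andbT; lra.
- by rewrite -[X in _ --> X]subr0; apply: cvgB => //; exact: cvg_cst.
- exact: cvg_cst.
Unshelve. all: by end_near. Qed.

End grid.

(** * The action as a finite part plus a nonnegative potential part, and its lower bound by Riemann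
    sums *)

Section lagrangian.
Variables (R : realType) (T : R) (S : set (V3 R)).
Variables (A : R -> V3 R -> V3 R) (Phi : R -> V3 R -> R) (c : R).
Hypotheses (T0 : 0 < T) (cS : closed (S : set 'rV[R]_3)).
Hypotheses (hA : classA T A) (hP : classP T S Phi).
Hypothesis hc : forall t x, ~ S x -> Phi t x <= c.
Local Notation mu := (@lebesgue_measure R).
Implicit Types (q g : R -> V3 R).

Definition lip1 q := forall s t, enorm (q s - q t) <= `|s - t|.

Definition kin (v : V3 R) : R := 1 - Num.sqrt (1 - enorm v ^+ 2).
(** The velocity is a separate argument, so that a measurable density [g] bounded everywhere can
    stand for [derive1 q]. *)
Definition lag q g t : R := kin (g t) + dot3 (g t) (A t (q t)).
(** With [c] an upper bound of [Phi] off [S], the integrand is nonnegative along admissible curves,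
    and the integral has a meaning in [[0, +oo]]. *)
Definition pot q : \bar R := (\int[mu]_(t in `[0%R, T]) (c - Phi t (q t))%:E)%E.

Definition density q g := [/\ mvec setT g, forall t, enorm (g t) <= 1,
  forall i a b, 0 <= a -> a <= b -> b <= T ->
    \int[mu]_(t in `[a, b]) g t ord0 i = q b ord0 i - q a ord0 i &
  {ae mu, forall t, 0 < t < T -> derivable q t 1 /\ derive1 q t = g t}].

Lemma lip1_continuous q : lip1 q -> continuous (q : R -> 'rV[R]_3).
Proof.
move=> lq t; apply/cvg_enormP; apply: (@squeeze_cvgr _ _ _ _ (cst 0) (fun s => `|s - t|)).
- by near=> s; rewrite enorm_ge0 lq.
- exact: cvg_cst.
- rewrite [X in _ --> X](_ : 0 = `|t - t|); last by rewrite subrr normr0.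
  by apply: cvg_norm; apply: cvgB; [exact: cvg_id|exact: cvg_cst].
Unshelve. all: by end_near. Qed.

Lemma kin_bounds v : 0 <= kin v <= 1.
Proof.
rewrite /kin lerBlDr lerDl sqrtr_ge0 andbT subr_ge0.
rewrite -[leRHS]sqrtr1 ler_sqrt//.
by rewrite lerBlDr lerDl sqr_ge0.
Qed.

Lemma kin_continuous : continuous (kin : 'rV[R]_3 -> R).
Proof.
move=> v; apply: (@cvgB _ _ _ _ (nbhs_filter v)); first exact: cvg_cst.
apply: (@continuous_comp _ _ _ (fun v : 'rV[R]_3 => 1 - enorm v ^+ 2) (@Num.sqrt R)); last exact: sqrt_continuous.
apply: (@cvgB _ _ _ _ (nbhs_filter v)); first exact: cvg_cst.
by rewrite expr2; apply: (@cvgM _ _ _ (nbhs_filter v)); exact: enorm_continuous.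
Qed.

Lemma A_curve_lip q : lip1 q -> exists C : R, 0 <= C /\ forall s t, 0 <= s <= T -> 0 <= t <= T ->
  enorm (A t (q t) - A s (q s)) <= C * `|t - s|.
Proof.
move=> lq; have [C [C0 HC]] := classA_lip hA; exists (2 * C); split; first by lra.
move=> s t s0 t0; apply: (le_trans (HC _ _ _ _ s0 t0)).
by have := lq t s; move: (enorm _) `|t - s| => u v *; nra.
Qed.

Lemma A_curve_measurable q : lip1 q -> mvec `[0, T] (fun t => A t (q t)).
Proof.
move=> lq i; have [C [C0 HC]] := A_curve_lip lq.
(* The Lipschitz bound is available for times in [[0, T]] only. Clamping the time is 1-Lipschitz and
   yields a Lipschitz, hence measurable, extension to the line. *)
pose cl (t : R) := Num.max 0 (Num.min T t).
have clT t : 0 <= cl t <= T by rewrite /cl le_max lexx/= ge_max ge_min lexx ltW.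
have lcl : lip C (fun t => A (cl t) (q (cl t)) ord0 i).
  move=> s t; apply: (@le_trans _ _ (C * `|cl s - cl t|)).
    have := le_trans (ler_coord_enorm _ i) (HC (cl t) (cl s) (clT t) (clT s)).
    by rewrite !mxE.
  rewrite ler_wpM2l// /cl.
  by rewrite /Num.max /Num.min; do ![case: ifPn]; rewrite -?leNgt => *; rewrite ler_norml; apply/andP; split; have := ler_norm (s - t); have := ler_norm (t - s); rewrite (distrC t s); lra.
have := continuous_measurable_fun (lip_continuous lcl).
move=> /(@measurable_funTS _ _ _ _ `[0, T]%classic).
apply: eq_measurable_fun => t; rewrite inE /= in_itv/= => /andP[t0 tT].
by rewrite /cl min_r// max_r.
Qed.

Lemma A_curve_bounded q : lip1 q -> exists M : R, forall t, 0 <= t <= T -> enorm (A t (q t)) <= M.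
Proof.
move=> lq; have [C [C0 HC]] := A_curve_lip lq.
exists (C * T + enorm (A 0 (q 0))) => t t0T.
apply: (le_trans (ler_enorm_sub _ (A 0 (q 0)))); rewrite lerD2r.
have /andP[t0 tT] := t0T.
apply: (le_trans (HC 0 t _ t0T)); first by rewrite lexx ltW.
by rewrite subr0 ger0_norm// ler_wpM2l.
Qed.

(** [Phi] is continuous in [t] and in [x] separately. Freezing the position at grid points gives
    functions that are measurable by continuity in [t]; they converge pointwise by continuity in
    [x]. *)
Lemma Phi_curve_measurable q : lip1 q -> (forall t, ~ S (q t)) ->
  measurable_fun `[0, T] (fun t => Phi t (q t)).
Proof.
move=> lq Sq; pose h n : R := T / n.+1%:R.
have h0 n : 0 < h n by rewrite divr_gt0.
apply: (@measurable_fun_cvg _ _ _ _ (fun n t => Phi t (q (grid (h n) t)))).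
  move=> n; apply: (@measurable_gidx_comp _ T (h n) (fun k t => Phi t (q (h n * k%:R)))) => // k.
  apply: measurable_funTS; apply: continuous_measurable_fun.
  by have [_ [_ [cP _]]] := hP; exact: cP.
move=> t; rewrite /= in_itv/= => /andP[t0 _].
apply: (@cvg_comp _ _ _ (fun n => q (grid (h n) t)) (Phi t) _ (nbhs (q t : 'rV[R]_3))).
  apply: (@cvg_comp _ _ _ (fun n => grid (h n) t) q _ (nbhs t)).
    by apply: cvg_grid => //; exact: cvg_step.
  exact: lip1_continuous.
exact: (classP_continuous cS hP).
Qed.

Lemma kin_measurable D g : mvec D g -> measurable_fun D (fun t => kin (g t)).
Proof.
move=> mg; apply: measurable_funB; first exact: measurable_cst.
apply: measurable_sqrt; apply: measurable_funB; first exact: measurable_cst.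
by apply: measurable_funX; exact: mvec_enorm.
Qed.

Lemma lag_measurable q g : lip1 q -> mvec setT g -> measurable_fun `[0, T] (lag q g).
Proof.
move=> lq mg; apply: measurable_funD; first by apply: kin_measurable; exact: mvecS.
by apply: mvec_dot3; [exact: mvecS|exact: A_curve_measurable].
Qed.

Lemma dot_le1 (v w : V3 R) : enorm v <= 1 -> `|dot3 v w| <= enorm w.
Proof.
move=> v1; apply: (le_trans (ler_dot3 _ _)).
by rewrite ler_piMl// enorm_ge0.
Qed.

Lemma lag_bounded q g : lip1 q -> (forall t, enorm (g t) <= 1) ->
  exists M : R, forall t, 0 <= t <= T -> `|lag q g t| <= M.
Proof.
move=> lq g1; have [M HM] := A_curve_bounded lq; exists (1 + M) => t tT.
apply: (le_trans (ler_normD _ _)); apply: lerD.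
  by have /andP[k0 k1] := kin_bounds (g t); rewrite ger0_norm.
exact: le_trans (dot_le1 _ (g1 t)) (HM _ tT).
Qed.

Lemma lag_integrable q g : lip1 q -> density q g -> mu.-integrable `[0, T] (EFin \o lag q g).
Proof.
move=> lq [mg g1 _ _]; have [M HM] := lag_bounded lq g1.
apply: (@bounded_integrable_itv _ _ _ 0 T _ M) => //; first exact: lag_measurable.
Qed.

Lemma EFin_Rintegral (f : R -> R) (D : set R) : measurable D -> mu.-integrable D (EFin \o f) ->
  (\int[mu]_(t in D) (f t)%:E)%E = (\int[mu]_(t in D) f t)%:E.
Proof. by move=> mD fi; rewrite /Rintegral fineK//; exact: integrable_fin_num. Qed.

Lemma pot_ge0 q : (forall t, ~ S (q t)) -> (0 <= pot q)%E.
Proof. by move=> Sq; apply: integral_ge0 => t _; rewrite lee_fin subr_ge0 hc. Qed.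

(** Adding and subtracting [c] confines a possibly infinite value to the nonnegative [pot q]; the
    other integrands are bounded once [derive1 q] is replaced by the density [g]. *)
Lemma actionE q g : inKLambda T S q -> density q g ->
  action T S A Phi q = ((\int[mu]_(t in `[0, T]) lag q g t - c * T)%:E + pot q)%E.
Proof.
move=> KLq dg; have [Kq [_ Sq]] := KLq; have lq : lip1 q by exact: inK_lip Kq.
have [mg g1 _ ag] := dg.
have aeg : {ae mu, forall t, `[0, T]%classic t -> derive1 q t = g t}.
  have n0T : {ae mu, forall t, t != 0 /\ t != T}.
    by apply: ae_imp2 (ae_neq 0) (ae_neq T) => t.
  apply: ae_imp2 ag n0T => t H [ta tb]; rewrite /= in_itv/= => /andP[ct td].
  have /H[_ -> //] : 0 < t < T by rewrite !lt_neqAle eq_sym ta tb ct td.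
have [M HM] := A_curve_bounded lq.
have idot : mu.-integrable `[0, T] (EFin \o (fun t => dot3 (g t) (A t (q t)))).
  apply: (@bounded_integrable_itv _ _ _ 0 T _ M) => //.
    by apply: mvec_dot3; [exact: mvecS|exact: A_curve_measurable].
  by move=> t; rewrite /= in_itv/= => tT; exact: le_trans (dot_le1 _ (g1 t)) (HM _ tT).
have icst : mu.-integrable `[0, T] (EFin \o cst c).
  by apply: (@bounded_integrable_itv _ _ _ 0 T _ `|c|).
have iu : mu.-integrable `[0, T] (EFin \o (fun t => dot3 (g t) (A t (q t)) - c)).
  by have := integrableB _ idot icst; apply.
have ikin : mu.-integrable `[0, T] (EFin \o (fun t => kin (g t))).
  apply: (@bounded_integrable_itv _ _ _ 0 T _ 1) => //.
    by apply: kin_measurable; exact: mvecS.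
  by move=> t _; have /andP[k0 k1] := kin_bounds (g t); rewrite ger0_norm.
have mPhi := Phi_curve_measurable lq Sq.
rewrite /action asboolT//.
transitivity (\int[mu]_(t in `[0%R, T]) (kin (g t))%:E + \int[mu]_(t in `[0%R, T])
    ((dot3 (g t) (A t (q t)) - c) + (c - Phi t (q t)))%:E)%E.
  congr (_ + _)%E.
    apply: (@ae_eq_lower_integral _ _ _ mu _ _ (fun t => (kin (g t))%:E)) => //.
      by apply/measurable_EFinP; apply: kin_measurable; exact: mvecS.
    by apply: ae_imp aeg => t /[apply] ->.
  apply: (@ae_eq_lower_integral _ _ _ mu _ _
      (fun t => ((dot3 (g t) (A t (q t)) - c) + (c - Phi t (q t)))%:E)) => //.
    apply/measurable_EFinP; apply: measurable_funD; last exact: measurable_funB.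
    by have /measurable_int/measurable_EFinP := iu.
  by apply: ae_imp aeg => t /[apply] ->; rewrite addrA subrK.
rewrite (@integral_bounded_add_ge0 _ _ _ mu _ (fun t => dot3 (g t) (A t (q t)) - c)
  (fun t => c - Phi t (q t)))//; last 2 first.
- exact: measurable_funB.
- by move=> t _; rewrite subr_ge0 hc.
rewrite -/(pot q) addeA; congr (_ + _)%E.
rewrite !EFin_Rintegral// -EFinD RintegralB//.
have -> : \int[mu]_(t in `[0, T]) lag q g t = \int[mu]_(t in `[0, T]) kin (g t) +
  \int[mu]_(t in `[0, T]) dot3 (g t) (A t (q t)) by exact: RintegralD.
have := @Rintegral_cst_itv R true false 0 T c (ltW T0).
by rewrite subr0 => ->; rewrite addrA.
Qed.

Lemma inKLambda_density q : inKLambda T S q -> exists g, density q g.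
Proof. by move=> [Kq _]; exact: inK_density Kq. Qed.

(* [1 - |v|^2 <= 1 - 2 v.w + |w|^2], followed by AM-GM in the form
   [2 sqrt s <= m s + 1/m]. *)
Lemma kin_affine_minorant (v w : V3 R) (m : R) : 0 < m -> enorm v <= 1 ->
  1 - (m * (1 + dot3 w w) + m^-1) / 2 + m * dot3 w v <= kin v.
Proof.
move=> m0 v1; rewrite /kin.
have s0 : 0 <= 1 - enorm v ^+ 2 by rewrite subr_ge0 expr_le1// enorm_ge0.
have := sqr_sqrtr s0; have := sqrtr_ge0 (1 - enorm v ^+ 2).
move: (Num.sqrt _) => r r0 rE.
have h1 : 2 * r <= m * r ^+ 2 + m^-1.
  rewrite -subr_ge0 (_ : _ - _ = (m * r - 1) ^+ 2 / m); last by field; rewrite gt_eqF.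
  by rewrite divr_ge0 ?sqr_ge0// ltW.
have h2 : 2 * dot3 w v <= dot3 w w + enorm v ^+ 2.
  have := dot3_ge0 (w - v); rewrite dot3Bl !dot3Br (dot3C v w) enorm_sqr; lra.
have h3 : m * (2 * dot3 w v) <= m * (dot3 w w + enorm v ^+ 2) by rewrite ler_pM2l.
rewrite rE in h1; nra.
Qed.

(** Jensen's inequality on one cell: with [w] the mean velocity, [kin_affine_minorant] bounds the
    integrand below by an affine function of [g t], whose integral involves only [q b - q a].
    Freezing [A] at the left endpoint costs at most [be] per unit of time because
    [enorm (g t) <= 1]. *)
Lemma lag_interval q g (a b be : R) : lip1 q -> density q g -> 0 <= a -> a < b -> b <= T ->
  (forall t, a <= t <= b -> enorm (A t (q t) - A a (q a)) <= be) ->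
  (b - a) * kin ((b - a)^-1 *: (q b - q a)) + dot3 (q b - q a) (A a (q a)) - be * (b - a)
  <= \int[mu]_(t in `[a, b]) lag q g t.
Proof.
move=> lq dg a0 ab bT Abe; have [mg g1 ig _] := dg.
have iab : mu.-integrable `[a, b] (EFin \o lag q g).
  apply: integrableS (lag_integrable lq dg) => //.
  by apply: subset_itv; rewrite bnd_simp.
set d := b - a; have d0 : 0 < d by rewrite subr_gt0.
set D := q b - q a; set w := d^-1 *: D.
have w1 : enorm w <= 1.
  rewrite /w enormZ ger0_norm ?invr_ge0 ?(ltW d0)// ler_pdivrMl// mulr1.
  by apply: (le_trans (lq _ _)); rewrite ger0_norm// ltW.
have DE : D = d *: w by rewrite scalerA mulfV ?scale1r// gt_eqF.
have s0 : 0 <= 1 - enorm w ^+ 2 by rewrite subr_ge0 expr_le1// enorm_ge0.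
clearbody w; have key m : 0 < m -> d * (1 - (m * (1 - enorm w ^+ 2) + m^-1) / 2) + dot3 D (A a (q a)) - be * d
    <= \int[mu]_(t in `[a, b]) lag q g t.
  move=> m0; pose u := m *: w + A a (q a).
  pose K := 1 - (m * (1 + dot3 w w) + m^-1) / 2 - be.
  have idot : mu.-integrable `[a, b] (EFin \o (fun t => dot3 u (g t))).
    apply: (@bounded_integrable_itv _ _ _ a b _ (enorm u)) => //.
      by apply: mvec_dot3; [exact: mvec_cst|exact: mvecS].
    by move=> t _; rewrite dot3C; exact: dot_le1.
  have iK : mu.-integrable `[a, b] (EFin \o cst K).
    by apply: (@bounded_integrable_itv _ _ _ a b _ `|K|).
  apply: (@le_trans _ _ (\int[mu]_(t in `[a, b]) (K + dot3 u (g t)))); last first.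
    apply: le_Rintegral => //.
      by have := integrableD _ iK idot; apply.
    move=> t; rewrite /= in_itv/= => tab.
    have h1 := kin_affine_minorant w m0 (g1 t).
    have h2 := dot_le1 (A t (q t) - A a (q a)) (g1 t).
    have h3 := Abe t tab.
    move: h2; rewrite ler_norml dot3Br => /andP[h2 _].
    rewrite /lag /K /u dot3Dl (dot3Zl m) (dot3C (A a (q a))).
    move: h1 h2 h3; move: (dot3 w w) (dot3 w (g t)) (kin (g t)) (dot3 (g t) (A t (q t)))
      (dot3 (g t) (A a (q a))) (enorm _) (m^-1) => *; lra.
  rewrite RintegralD// (@Rintegral_dot3 _ g q a b 1 u mg g1); last by move=> i; exact: ig (ltW ab) bT.
  have := @Rintegral_cst_itv R true false a b K (ltW ab) => /= ->.
  rewrite -/D -/d /u (dot3Dl (m *: w)) (dot3Zl m) (dot3C (A a _)) (dot3C w) DE !(dot3Zl d) enorm_sqr /K.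
  move: (dot3 w w) (dot3 w _) (m^-1) => *; lra.
(* The optimal [m] is [1 / sqrt (1 - |w|^2)]; adding [e'] to the denominator
   also covers [|w| = 1]. *)
apply/ler_addgt0Pr => e e0.
have r0 := sqrtr_ge0 (1 - enorm w ^+ 2).
have rE := sqr_sqrtr s0.
set r := Num.sqrt _ in r0 rE.
pose e' := e / d; have e'0 : 0 < e' by rewrite divr_gt0.
have re : 0 < r + e' by rewrite ltr_wpDl.
have m0 : 0 < (r + e')^-1 by rewrite invr_gt0.
have := key _ m0; rewrite invrK -rE.
have h : (r + e')^-1 * r ^+ 2 <= r.
  by rewrite ler_pdivrMl// expr2 mulrDl lerDl mulr_ge0// ltW.
have : d * (1 - (r + (r + e')) / 2) <= d * (1 - ((r + e')^-1 * r ^+ 2 + (r + e')) / 2).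
  by rewrite ler_pM2l//; lra.
have -> : d * (1 - (r + (r + e')) / 2) = d * (1 - r) - e / 2.
  by rewrite /e'; field; rewrite gt_eqF.
rewrite /kin -/r; lra.
Qed.

(** This is the kinetic and magnetic action of the piecewise linear interpolation of [q] with step
    [h], with [A] frozen at the left end of each cell. The magnetic term has no factor [h], as the
    increment of [q] already contains it. *)
Definition riemann q (n : nat) (h : R) : R :=
  \sum_(k < n) (h * kin (h^-1 *: (q (h * k.+1%:R) - q (h * k%:R))) +
    dot3 (q (h * k.+1%:R) - q (h * k%:R)) (A (h * k%:R) (q (h * k%:R)))).

Lemma riemann_le q g n be : lip1 q -> density q g ->
  (forall s t, 0 <= s -> s <= t -> t <= s + T / n.+1%:R -> t <= T ->
     enorm (A t (q t) - A s (q s)) <= be) ->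
  riemann q n.+1 (T / n.+1%:R) - be * T <= \int[mu]_(t in `[0, T]) lag q g t.
Proof.
move=> lq dg Abe; have [mg g1 _ _] := dg.
have [M HM] := lag_bounded lq g1.
set h := T / n.+1%:R; have h0 : 0 < h by rewrite divr_gt0.
have TE : T = h * n.+1%:R by rewrite mulfVK.
rewrite {1 2}TE (Rintegral_grid (M := M))//; last 2 first.
- by rewrite -TE; exact: lag_measurable.
- by rewrite -TE.
have -> : be * (h * n.+1%:R) = \sum_(k < n.+1) be * h.
  by rewrite sumr_const card_ord mulrA mulr_natr.
rewrite -sumrB; apply: ler_sum => k _.
have kE : h * k.+1%:R - h * k%:R = h by rewrite -mulrBr -natrB// subSnn mulr1.
have kn : h * k.+1%:R <= T by rewrite [leRHS]TE ler_pM2l// ler_nat.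
have k0 : 0 <= h * k%:R by rewrite mulr_ge0// ltW.
have := @lag_interval q g (h * k%:R) (h * k.+1%:R) be lq dg k0.
rewrite kE; apply => //; first by rewrite ltr_pM2l// ltr_nat.
move=> t /andP[kt tk]; apply: Abe => //; last exact: le_trans kn.
by rewrite -/h -{2}kE addrC subrK.
Qed.

End lagrangian.

(** * Lower bounds for the action, and convergence of the Riemann sums of a fixed curve *)

Section bounds.
Variables (R : realType) (T : R) (S : set (V3 R)).
Variables (A : R -> V3 R -> V3 R) (Phi : R -> V3 R -> R) (c : R).
Hypotheses (T0 : 0 < T) (cS : closed (S : set 'rV[R]_3)).
Hypotheses (hA : classA T A) (hP : classP T S Phi).
Hypothesis hc : forall t x, ~ S x -> Phi t x <= c.
Local Notation mu := (@lebesgue_measure R).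
Local Notation lag := (lag A).
Local Notation pot := (pot T Phi c).
Local Notation density := (density T).
Implicit Types (q g : R -> V3 R).

Lemma kin0 : kin (0 : V3 R) = 0.
Proof. by rewrite /kin enorm0 expr0n subr0 sqrtr1 subrr. Qed.

(** [lag_interval] is used with [[0, T]] as a single cell: by periodicity the increment vanishes and
    only the error term survives. *)
Lemma lag_ge q g be : lip1 q -> (forall t, q (t + T) = q t) -> density q g ->
  (forall t, 0 <= t <= T -> enorm (A t (q t) - A 0 (q 0)) <= be) ->
  - (be * T) <= \int[mu]_(t in `[0, T]) lag q g t.
Proof.
move=> lq pq dg Abe.
have := lag_interval T0 hA lq dg (lexx 0) T0 (lexx T) Abe.
have -> : q T = q 0 by rewrite -[T in LHS]add0r pq.
by rewrite !subrr scaler0 kin0 mulr0 dot30l !add0r subr0.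
Qed.

(** The curve is compared with the constant curve at [q 0], for which [phi <= 0] makes the integral
    of [c - Phi] at least [c * T]. Putting [eta] on the larger side keeps both integrands
    nonnegative, so an infinite [pot q] is allowed. *)
Lemma pot_ge q (eta : R) : lip1 q -> (forall t, ~ S (q t)) -> 0 <= eta ->
  (forall t, 0 <= t <= T -> Phi t (q t) <= Phi t (q 0) + eta) ->
  (phi T Phi (q 0%R) <= 0)%E -> (((c - eta) * T)%:E <= pot q)%E.
Proof.
move=> lq Sq eta0 Peta phi0; have [_ [_ [cP _]]] := hP.
have icst (k : R) : mu.-integrable `[0, T] (EFin \o cst k).
  by apply: (@bounded_integrable_itv _ _ _ 0 T _ `|k|).
have iP : mu.-integrable `[0, T] (EFin \o (fun t => Phi t (q 0))).
  apply: continuous_compact_integrable; first exact: segment_compact.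
  by apply: continuous_subspaceT; exact: cP.
have mP := Phi_curve_measurable T0 cS hP lq Sq.
have Ecst (k : R) : (\int[mu]_(t in `[0%R, T]) k%:E = (k * T)%:E)%E.
  rewrite (@EFin_Rintegral _ (cst k))//.
  by have := @Rintegral_cst_itv R true false 0 T k (ltW T0); rewrite subr0 => /= ->.
have : (\int[mu]_(t in `[0%R, T]) (c - Phi t (q 0))%:E <=
        \int[mu]_(t in `[0%R, T]) (eta + (c - Phi t (q t)))%:E)%E.
  apply: ge0_le_integral => //.
  - by move=> t _; rewrite lee_fin subr_ge0 hc.
  - by apply/measurable_EFinP; apply: measurable_funB => //; have /measurable_int/measurable_EFinP := iP.
  - by apply/measurable_EFinP; apply: measurable_funD => //; exact: measurable_funB.
  - by move=> t; rewrite /= in_itv/= lee_fin => /Peta; lra.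
rewrite (@integral_bounded_add_ge0 _ _ _ mu _ (cst eta) (fun t => c - Phi t (q t)))//; last 2 first.
- exact: measurable_funB.
- by move=> t _; rewrite subr_ge0 hc.
rewrite -/(pot q) /= Ecst.
have -> : (\int[mu]_(t in `[0%R, T]) (c - Phi t (q 0%R))%:E = (c * T)%:E - phi T Phi (q 0%R))%E.
  have iD : mu.-integrable `[0, T] (EFin \o (fun t => c - Phi t (q 0))).
    by have := integrableB _ (icst c) iP; apply.
  rewrite /phi !EFin_Rintegral// -EFinB RintegralB//; last exact: icst.
  by have := @Rintegral_cst_itv R true false 0 T c (ltW T0); rewrite subr0 => /= ->.
move: phi0; rewrite /phi EFin_Rintegral//.
move: (\int[mu]_(t in `[0, T]) Phi t (q 0)) => p; rewrite lee_fin => p0.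
rewrite -EFinB; case: (pot q) => [r| |]//=; last by move=> _; rewrite leey.
by rewrite -EFinD !lee_fin; lra.
Qed.

Lemma action_ge q (be eta : R) : inKLambda T S q -> 0 <= eta ->
  (forall t, 0 <= t <= T -> enorm (A t (q t) - A 0 (q 0)) <= be) ->
  (forall t, 0 <= t <= T -> Phi t (q t) <= Phi t (q 0) + eta) ->
  (phi T Phi (q 0%R) <= 0)%E -> ((- ((be + eta) * T))%:E <= action T S A Phi q)%E.
Proof.
move=> KLq eta0 Abe Peta phi0.
have [Kq [_ Sq]] := KLq; have lq : lip1 q by exact: inK_lip Kq.
have [g dg] := inKLambda_density T0 KLq.
rewrite (actionE T0 cS hA hP hc KLq dg).
have h1 := lag_ge lq Kq.1.2 dg Abe.
have h2 := pot_ge lq Sq eta0 Peta phi0.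
apply: (le_trans _ (leeD2l _ h2)); rewrite -EFinD lee_fin.
move: (\int[mu]_(t in `[0, T]) lag q g t) h1 => I h1; lra.
Qed.

Lemma action_const_ge0 q : inKLambda T S q -> (forall t, q t = q 0) ->
  (phi T Phi (q 0%R) <= 0)%E -> (0 <= action T S A Phi q)%E.
Proof.
move=> KLq qc phi0.
have [Kq [_ Sq]] := KLq; have lq : lip1 q by exact: inK_lip Kq.
have qE : q = cst (q 0) by apply/funext => t; rewrite qc.
have dg : density q (fun=> 0).
  split.
  - exact: mvec_cst.
  - by move=> t; rewrite enorm0.
  - move=> i a b a0 ab bT; rewrite (qc b) (qc a) subrr.
    under eq_Rintegral do rewrite mxE.
    by rewrite (Rintegral_cst_itv true false 0 ab) mul0r.
  - apply: aeW => t _; rewrite qE derive1E; split; first exact: derivable_cst.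
    exact: derive_cst.
rewrite (actionE T0 cS hA hP hc KLq dg).
have -> : \int[mu]_(t in `[0, T]) lag q (fun=> 0) t = 0.
  rewrite (@eq_Rintegral _ _ _ mu _ (fun=> 0)); last first.
    move=> t _; transitivity (kin (0 : V3 R) + dot3 0 (A t (q t))) => //.
    by rewrite kin0 dot30l addr0.
  by rewrite (Rintegral_cst_itv true false 0 (ltW T0)) mul0r.
have h2 := @pot_ge q 0 lq Sq (lexx 0).
apply: (@le_trans _ _ ((0 - c * T)%:E + ((c - 0) * T)%:E)%E).
  by rewrite -EFinD lee_fin; lra.
apply: leeD2l; apply: h2 => // t _.
by rewrite addr0 (qc t).
Qed.

Lemma action_far (e : R) : 0 < e -> compact (S : set 'rV[R]_3) ->
  (forall x, ~ S x -> (phi T Phi x <= 0)%E) ->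
  exists M : R, forall q, inKLambda T S q -> M < enorm (q 0) ->
    ((- e)%:E <= action T S A Phi q)%E.
Proof.
move=> e0 cpS phi0.
(* Write [e'] for this constant. During one period the curve stays within [T] of [q 0], so [A]
   changes by at most [e' * (2 * T)] and [Phi] by at most [e' * T]; integrated over a period the
   loss is [3 * e' * T^2 = e]. *)
have e1 : 0 < e / (3 * T ^+ 2) by rewrite divr_gt0// mulr_gt0// exprn_gt0.
have [M1 H1] := classA_far hA e1.
have [M2 H2] := classP_far hP e1 cpS.
exists (Num.max M1 M2 + T) => q KLq qM.
have [Kq [_ Sq]] := KLq; have lq : lip1 q by exact: inK_lip Kq.
set e' := e / (3 * T ^+ 2) in e1 H1 H2.
have -> : e = (e' * (2 * T) + e' * T) * T.
  by rewrite /e'; field; rewrite gt_eqF.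
have qt t : 0 <= t <= T -> enorm (q t - q 0) <= T.
  by move=> /andP[t_0 tT]; apply: (le_trans (lq _ _)); rewrite subr0 ger0_norm.
have far t : 0 <= t <= T -> M1 < enorm (q 0) - enorm (q t - q 0) /\ M2 < enorm (q 0) - enorm (q t - q 0).
  move=> /qt h; have h1 : M1 <= Num.max M1 M2 by rewrite le_max lexx.
  have h2 : M2 <= Num.max M1 M2 by rewrite le_max lexx orbT.
  by split; lra.
apply: action_ge => //.
- by rewrite mulr_ge0// ltW.
- move=> t tT; have [f1 _] := far t tT; apply: (le_trans (H1 _ _ _ _ f1)).
  rewrite ler_pM2l// subr0 mulr2n mulrDl mul1r lerD// ?qt//.
  by have /andP[t_0 t1] := tT; rewrite ger0_norm.
- move=> t tT; have [_ f2] := far t tT; have [_ h] := H2 t _ _ f2.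
  have h3 : e' * enorm (q t - q 0) <= e' * T by rewrite ler_pM2l// qt.
  have := ler_norm (Phi t (q t) - Phi t (q 0)); lra.
- exact/phi0/Sq.
Qed.

(** A grid cell contains [t] without having it as an endpoint. The errors of the linear
    approximation at the two ends, [e * (b - t)] and [e * (t - a)], add up to [e * (b - a)]. *)
Lemma straddle q t v : derivable q t 1 -> derive1 q t = v ->
  forall e, 0 < e -> exists d : R, 0 < d /\ forall a b, a <= t -> t <= b -> a < b -> b - a < d ->
    enorm ((b - a)^-1 *: (q b - q a) - v) <= e.
Proof.
move=> dq qv e e0.
have : h^-1 *: (q (h *: 1 + t) - q t) @[h --> 0^'] --> 'D_1 q t by exact: dq.
rewrite -derive1E qv => /cvg_enormP/cvgr0Pnorm_le/(_ _ e0)[d /= d0 Hd].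
exists d; split => // a b a_t tb ab bad.
have H s : `|s - t| < d -> enorm (q s - q t - (s - t) *: v) <= e * `|s - t|.
  move=> st; have [->|snt] := eqVneq s t.
    by rewrite !subrr scale0r subrr enorm0 normr0 mulr0.
  have snt0 : s - t != 0 by rewrite subr_eq0.
  have := Hd (s - t); rewrite /= sub0r normrN => /(_ st snt0).
  rewrite [(s - t) *: 1]mulr1 subrK ger0_norm ?enorm_ge0// => h.
  have -> : q s - q t - (s - t) *: v = (s - t) *: ((s - t)^-1 *: (q s - q t) - v).
    by rewrite scalerBr scalerA mulfV// scale1r.
  by rewrite enormZ mulrC ler_wpM2r.
have ba0 : 0 < b - a by rewrite subr_gt0.
have -> : (b - a)^-1 *: (q b - q a) - v =
    (b - a)^-1 *: ((q b - q t - (b - t) *: v) - (q a - q t - (a - t) *: v)).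
  have -> : q b - q t - (b - t) *: v - (q a - q t - (a - t) *: v) = (q b - q a) - (b - a) *: v.
    by apply/rowP => i; rewrite !mxE; ring.
  by rewrite [RHS]scalerBr scalerA mulVf ?scale1r// gt_eqF.
rewrite enormZ ger0_norm ?invr_ge0 ?(ltW ba0)// ler_pdivrMl//.
apply: (le_trans (ler_enormD _ _)); rewrite enormN.
have h1 : `|b - t| < d by rewrite ger0_norm ?subr_ge0//; lra.
have h2 : `|a - t| < d by rewrite ler0_norm ?subr_le0//; lra.
apply: (le_trans (lerD (H _ h1) (H _ h2))).
by rewrite ger0_norm ?subr_ge0// ler0_norm ?subr_le0//; lra.
Qed.

Lemma cvg_dot3 (u v : nat -> V3 R) (a b : V3 R) : u @ \oo --> (a : 'rV[R]_3) -> v @ \oo --> (b : 'rV[R]_3) ->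
  dot3 (u n) (v n) @[n --> \oo] --> dot3 a b.
Proof.
move=> ua vb.
have ci (w : nat -> V3 R) (l : V3 R) i : w @ \oo --> (l : 'rV[R]_3) -> w n ord0 i @[n --> \oo] --> l ord0 i.
  move=> wl; apply: (@cvg_comp _ _ _ w (fun M : 'rV[R]_3 => M ord0 i) _ (nbhs (l : 'rV[R]_3))) => //.
  exact: coord_continuous.
rewrite dot3E; under eq_fun do rewrite dot3E.
by apply: cvgD; [apply: cvgD|]; apply: cvgM; exact: ci.
Qed.

Lemma cvg_A (s : nat -> R) (x : nat -> V3 R) (t : R) (y : V3 R) :
  (forall n, 0 <= s n <= T) -> 0 <= t <= T -> s @ \oo --> t -> x @ \oo --> (y : 'rV[R]_3) ->
  A (s n) (x n) @[n --> \oo] --> (A t y : 'rV[R]_3).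
Proof.
move=> sT tT st xy; have [C [C0 HC]] := classA_lip hA.
apply/cvg_enormP; apply: (@squeeze_cvgr _ _ _ _ (cst 0) (fun n => C * (`|s n - t| + enorm (x n - y)))).
- by near=> n; rewrite enorm_ge0/=; apply: HC.
- exact: cvg_cst.
- rewrite [X in _ --> X](_ : 0 = C * (`|t - t| + 0)); last by rewrite subrr normr0 addr0 mulr0.
  apply: cvgM; first exact: cvg_cst.
  apply: cvgD; last exact/cvg_enormP.
  by apply: cvg_norm; apply: cvgB => //; exact: cvg_cst.
Unshelve. all: by end_near. Qed.

(** The summand of [riemann] divided by [h], that is, the value on the [k]-th cell of a step
    function whose integral is the Riemann sum. *)
Definition step_val q (h : R) (k : nat) : R :=
  kin (h^-1 *: (q (h * k.+1%:R) - q (h * k%:R))) +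
  dot3 (h^-1 *: (q (h * k.+1%:R) - q (h * k%:R))) (A (h * k%:R) (q (h * k%:R))).

Lemma step_val_bounded q : lip1 q -> exists M : R, forall h k, 0 < h -> h * k%:R <= T ->
  `|step_val q h k| <= M.
Proof.
move=> lq; have [M HM] := A_curve_bounded T0 hA lq; exists (1 + M) => h k h0 kT.
apply: (le_trans (ler_normD _ _)); apply: lerD.
  have := kin_bounds (h^-1 *: (q (h * k.+1%:R) - q (h * k%:R))).
  by move=> /andP[k0 k1]; rewrite ger0_norm.
apply: le_trans (dot_le1 _ _) (HM _ _); last by rewrite kT mulr_ge0// ltW.
rewrite enormZ ger0_norm ?invr_ge0 ?(ltW h0)// ler_pdivrMl// mulr1.
apply: (le_trans (lq _ _)); rewrite -mulrBr -natrB// subSnn mulr1.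
by rewrite ger0_norm// ltW.
Qed.

(** The step functions [f n] are uniformly bounded. At almost every [t] the cell velocity tends to
    [g t] by [straddle] and the left grid point tends to [t], so [f n t] tends to [lag q g t]. *)
Lemma cvg_riemann q g : lip1 q -> density q g ->
  riemann A q n.+1 (T / n.+1%:R) @[n --> \oo] --> \int[mu]_(t in `[0, T]) lag q g t.
Proof.
move=> lq dg; have [mg g1 _ ag] := dg.
have [M HM] := step_val_bounded lq.
pose h n : R := T / n.+1%:R.
have h0 n : 0 < h n by rewrite divr_gt0.
have hE n : h n * n.+1%:R = T by rewrite mulfVK.
pose f n t := step_val q (h n) (gidx (h n) t).
have fM n t : 0 <= t <= T -> `|f n t| <= M.
  move=> /andP[t_0 tT]; apply: HM => //.
  by have /andP[h1 _] := grid_itv (h0 n) t_0; exact: le_trans h1 tT.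
have mf n : measurable_fun `[0, T] (f n).
  by apply: (@measurable_gidx_comp _ T (h n) (fun k _ => step_val q (h n) k)).
have intf n : \int[mu]_(t in `[0, T]) f n t = riemann A q n.+1 (h n).
  rewrite -{1}(hE n) (Rintegral_grid (M := M))//; last 2 first.
  - by rewrite hE.
  - by rewrite hE; exact: fM.
  apply: eq_bigr => k _.
  have kk : h n * k%:R <= h n * k.+1%:R by rewrite ler_pM2l// ler_nat.
  have E t : h n * k%:R <= t < h n * k.+1%:R -> f n t = step_val q (h n) k.
    by move=> tk; rewrite /f (gidx_eq _ tk).
  have kT : h n * k%:R <= T by rewrite -(hE n) ler_pM2l// ler_nat ltnW.
  (* At the right endpoint [gidx] already has the next index, so that point is removed before the
     integrand is replaced by a constant. *)
  rewrite -(@Rintegral_itv_bndo_bndc _ (BLeft (h n * k%:R)) (h n * k.+1%:R)); last first.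
    apply: (@bounded_integrable_itv _ _ _ (h n * k%:R) (h n * k.+1%:R) _ M) => //.
    - by apply: subset_itvl; rewrite bnd_simp.
    - apply: measurable_funS (mf n) => //; apply: subset_itv; rewrite bnd_simp.
        by rewrite mulr_ge0// ltW.
      by rewrite -[leRHS](hE n) ler_pM2l// ler_nat.
    - move=> t; rewrite /= in_itv/= => /E ->; exact: HM.
  rewrite (@eq_Rintegral _ _ _ mu _ (fun=> step_val q (h n) k)); last first.
    by move=> t; rewrite inE/= in_itv/= => /E.
  have := @Rintegral_cst_itv R true true _ _ (step_val q (h n) k) kk => /= ->.
  rewrite -mulrBr -natrB// subSnn mulr1 /step_val mulrDl mulrC; congr (_ + _).
  by rewrite dot3Zl mulrAC mulVf ?mul1r// gt_eqF.
have cvgf : {ae mu, forall t, `[0, T]%classic t -> (f n t)%:E @[n --> \oo] --> (lag q g t)%:E}.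
  have n0T : {ae mu, forall t, t != 0 /\ t != T}.
    by apply: ae_imp2 (ae_neq 0) (ae_neq T) => t.
  apply: ae_imp2 ag n0T => t H [ta tb]; rewrite /= in_itv/= => /andP[ct td].
  have /H[dqt qg] : 0 < t < T by rewrite !lt_neqAle eq_sym ta tb ct td.
  apply: cvg_EFin; first by near=> n.
  have hh : h @ \oo --> (0 : R) by exact: cvg_step.
  have gr := cvg_grid h0 hh ct.
  have grT n : 0 <= grid (h n) t <= T.
    by have /andP[h1 _] := grid_itv (h0 n) ct; rewrite grid_ge0// (le_trans h1 td).
  have quo : (h n)^-1 *: (q (h n * (gidx (h n) t).+1%:R) - q (h n * (gidx (h n) t)%:R)) @[n --> \oo] --> (g t : 'rV[R]_3).
    apply/cvg_enormP/cvgr0Pnorm_le => e e0.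
    have [d [d0 Hd]] := straddle dqt qg e0.
    have /cvgr0Pnorm_lt/(_ _ d0) := hh; apply: filterS => n hn.
    rewrite ger0_norm ?enorm_ge0//.
    have /andP[g0 g2] := grid_itv (h0 n) ct.
    have gE : h n * (gidx (h n) t).+1%:R = grid (h n) t + h n by rewrite -natr1 mulrDr mulr1.
    have := Hd (grid (h n) t) (grid (h n) t + h n) g0 (ltW g2).
    rewrite addrAC subrr add0r gE; apply; first by rewrite ltrDl.
    by rewrite -[ltLHS]ger0_norm// ltW.
  apply: (@cvgD _ _ _ _ _ (fun n => kin _)).
    apply: (@cvg_comp _ _ _ _ (@kin R) _ (nbhs (g t : 'rV[R]_3))); first exact: quo.
    exact: kin_continuous.
  apply: cvg_dot3; first exact: quo.
  apply: cvg_A => //; first by rewrite ct td.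
  apply: (@cvg_comp _ _ _ (fun n => grid (h n) t) q _ (nbhs t)) => //.
  exact: lip1_continuous.
have [] := @dominated_convergence _ _ R mu `[0, T]%classic _ (fun n => EFin \o f n) (EFin \o lag q g) (EFin \o cst M).
- by [].
- by move=> n; apply/measurable_EFinP; exact: mf.
- by apply/measurable_EFinP; exact: lag_measurable.
- exact: cvgf.
- by apply: (@bounded_integrable_itv _ _ _ 0 T _ `|M|).
- by apply: aeW => t n; rewrite /= in_itv/= lee_fin => /fM.
move=> ilag _; rewrite [X in _ --> X]EFin_Rintegral// => /fine_cvg.
by under [X in X @ _ --> _ -> _]eq_fun do rewrite /= -/(Rintegral _ _ _) intf.
Unshelve. all: by end_near. Qed.

End bounds.

(** * Compactness of bounded families of 1-Lipschitz curves *)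

Section extraction.
Variable R : realType.

(** Tychonoff's theorem yields a cluster point [f] for pointwise convergence, and its neighbourhoods
    control finitely many times at once. Choosing [u k >= k] such that [q (u k)] is close to [f] on
    ever finer finite nets, the common Lipschitz constant gives convergence at every time. *)
Lemma lip1_subsequence (q : nat -> R -> V3 R) (M : R) :
  (forall n, lip1 (q n)) -> (forall n, enorm (q n 0) <= M) ->
  exists (u : nat -> nat) (f : R -> V3 R), [/\ forall k, (k <= u k)%N, lip1 f &
    forall t, q (u k) t @[k --> \oo] --> (f t : 'rV[R]_3)].
Proof.
move=> lq qM.
pose K (t : R) : set 'rV[R]_3 := [set x | forall i, `[- (M + `|t|), M + `|t|]%classic (x ord0 i)].
have cK : compact [set f : prod_topology (fun _ : R => 'rV[R]_3) | forall t, K t (f t)].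
  exact: (@tychonoff R (fun=> 'rV[R]_3) K (fun t => @compact_cube R (M + `|t|))).
pose F := (fun n => q n : prod_topology (fun _ : R => 'rV[R]_3)) @ \oo.
have FK : F [set f | forall t, K t (f t)].
  exists 0%N => // n _ /= t i; rewrite /= in_itv/= -ler_norml.
  apply: (le_trans (ler_coord_enorm _ _)); apply: (le_trans (ler_enorm_sub _ (q n 0))).
  by rewrite addrC lerD//; have := lq n t 0; rewrite subr0.
have [f [_ clf]] := cK F _ FK.
have key (l : seq R) (e : R) (k : nat) : 0 < e ->
    exists n, (k <= n)%N /\ forall s, s \in l -> enorm (q n s - f s) < e.
  move=> e0.
  have B : nbhs f [set g : prod_topology (fun _ : R => 'rV[R]_3) | forall s, s \in l -> enorm (g s - f s) < e].
    elim: l => [|s l IH]; first by apply: filterE => g s.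
    have Bs : nbhs f [set g : prod_topology (fun _ : R => 'rV[R]_3) | enorm (g s - f s) < e].
      have : (fun g : prod_topology (fun _ : R => 'rV[R]_3) => g s) @ f --> (f s : 'rV[R]_3).
        exact: (@proj_continuous R (fun=> 'rV[R]_3) s f).
      move=> /cvg_enormP/cvgr0Pnorm_lt/(_ _ e0); apply: filterS => g.
      by rewrite /= ger0_norm ?enorm_ge0.
    apply: filterS2 Bs IH => g gs IH s'; rewrite inE => /predU1P[->//|]; exact: IH.
  have Fk : F [set g | exists2 n, (k <= n)%N & q n = g] by exists k => // n /= kn; exists n.
  have [g [[n kn <-] Bg]] := clf _ _ Fk B.
  by exists n.
have lf : lip1 f.
  move=> s t; apply/ler_addgt0Pr => e e0.
  have e2 : 0 < e / 2 by rewrite divr_gt0.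
  have [n [_ H]] := key [:: s; t] (e / 2) 0%N e2.
  have Hs := H s; have Ht := H t; move: Hs Ht; rewrite !inE !eqxx orbT => /(_ isT) Hs /(_ isT) Ht.
  have -> : f s - f t = (q n s - q n t) + ((q n t - f t) - (q n s - f s)).
    by apply/rowP => i; rewrite !mxE; ring.
  apply: (le_trans (ler_enormD _ _)); apply: lerD; first exact: lq.
  by apply: (le_trans (ler_enormD _ _)); rewrite enormN; lra.
(* The points of [[- k, k]] with spacing [1 / (k + 1)]: the last index [2 * k * (k + 1)] gives [k],
   hence the length [.+1] of the list. Replacing [t] by a net point costs one spacing for [q (u k)]
   and one for [f]; with the closeness on the net this makes the factor 3 below. *)
pose net k := [seq j%:R / k.+1%:R - k%:R : R | j <- iota 0 (2 * k * k.+1).+1].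
have [u Hu] := choice (fun k => key (net k) (k.+1%:R^-1) k (ltac:(by rewrite invr_gt0))).
exists u, f; split => //; first by move=> k; have [] := Hu k.
move=> t; apply/cvg_enormP.
apply: (@squeeze_cvgr _ _ _ _ (cst 0) (fun k => 3 * k.+1%:R^-1)).
- near=> k; rewrite enorm_ge0/=.
  have k1 : 0 < k.+1%:R :> R by rewrite ltr0n.
  have tk : `|t| <= k%:R.
    apply: ltW; apply: (lt_le_trans (archi_boundP (normr_ge0 t))); rewrite ler_nat.
    by near: k; exact: nbhs_infty_ge.
  pose j := Num.truncn ((t + k%:R) * k.+1%:R).
  have tk0 : 0 <= t + k%:R by move: tk; rewrite ler_norml => /andP[]; lra.
  have /andP[j1 j2] : j%:R <= (t + k%:R) * k.+1%:R < j.+1%:R.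
    by apply: truncn_itv; rewrite mulr_ge0.
  pose s : R := j%:R / k.+1%:R - k%:R.
  have sn : s \in net k.
    apply/mapP; exists j => //; rewrite mem_iota leq0n add0n ltnS -(ler_nat R) (le_trans j1)//.
    rewrite !natrM ler_pM2r//; move: tk; rewrite ler_norml => /andP[_]; lra.
  have ts : `|t - s| <= k.+1%:R^-1.
    have -> : t - s = ((t + k%:R) * k.+1%:R - j%:R) / k.+1%:R.
      by rewrite /s; field; rewrite gt_eqF.
    rewrite normrM normfV (gtr0_norm k1) ler_piMl ?invr_ge0 ?(ltW k1)//.
    by rewrite ger0_norm ?subr_ge0//; move: j2; rewrite -natr1; lra.
  have [_ /(_ s sn) H] := Hu k.
  have -> : q (u k) t - f t = (q (u k) t - q (u k) s) + ((q (u k) s - f s) + (f s - f t)).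
    by apply/rowP => i; rewrite !mxE; ring.
  have h1 := le_trans (lq (u k) t s) ts.
  have h2 := lf s t; rewrite distrC in h2; have {}h2 := le_trans h2 ts.
  apply: (le_trans (ler_enormD _ _)).
  have := ler_enormD (q (u k) s - f s) (f s - f t).
  by move: h1 H h2; move: (k.+1%:R^-1) => z; lra.
- exact: cvg_cst.
- rewrite [X in _ --> X](_ : 0 = 3 * 0); last by rewrite mulr0.
  by apply: cvgM; [exact: cvg_cst|exact: cvg_harmonic].
Unshelve. all: by end_near. Qed.

End extraction.

(** * Limits of curves of bounded potential do not touch the obstacle *)

Section collision.
Variable R : realType.
Local Notation mu := (@lebesgue_measure R).

Lemma inv_shift_continuous (t0 e d r : R) : 0 < d ->
  {within `[t0, t0 + e], continuous (fun s : R => r / (s - t0 + d))}.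
Proof.
move=> d0; apply: continuous_in_subspaceT => t; rewrite inE/= in_itv/= => /andP[t1 _].
apply: cvgM; first exact: cvg_cst.
apply: cvgV; first by rewrite gt_eqF//; lra.
by apply: cvgD; [apply: cvgB; [exact: cvg_id|exact: cvg_cst]|exact: cvg_cst].
Qed.

Lemma integral_inv_shift (t0 e d r : R) : 0 < e -> 0 < d ->
  (\int[mu]_(t in `[t0, (t0 + e)%R]) (r / (t - t0 + d))%:E)%E = (r * (ln (e + d) - ln d))%:E.
Proof.
move=> e0 d0.
pose F (t : R) := r * ln (t - t0 + d).
have dF t : t0 - d < t -> is_derive t 1 F (r / (t - t0 + d)).
  move=> tt; have tp : 0 < t - t0 + d by lra.
  have h1 : is_derive t 1 (fun s : R => s - t0 + d) 1.
    have := is_deriveD (is_deriveB (is_derive_id t 1) (is_derive_cst t0 t 1)) (is_derive_cst d t 1).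
    by rewrite subr0 addr0.
  have h2 := @is_derive1_comp _ (@ln R) (fun s : R => s - t0 + d) t _ _ (is_derive1_ln tp) h1.
  by have := is_deriveZ r h2; rewrite mulr1.
have cF t : t0 - d < t -> {for t, continuous F}.
  move=> /dF dFt; apply/differentiable_continuous/derivable1_diffP; exact: ex_derive.
rewrite (@continuous_FTC2 R _ F t0 (t0 + e)).
- by rewrite -EFinB /F -mulrBr; congr (EFin (r * (ln _ - ln _))); ring.
- by rewrite ltrDl.
- exact: inv_shift_continuous.
- split.
  + move=> t; rewrite in_itv/= => /andP[t1 _].
    have := dF t (ltac:(lra)) => dFt; exact: ex_derive.
  + by apply: cvg_at_right_filter; apply: cF; lra.
  + by apply: cvg_at_left_filter; apply: cF; lra.
- move=> t; rewrite in_itv/= => /andP[t1 _]; rewrite derive1E.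
  have := dF t (ltac:(lra)) => dFt; exact: derive_val.
Qed.

Lemma periodic_reduce (X : Type) (q : R -> X) (T t : R) : 0 < T -> (forall t, q (t + T) = q t) ->
  exists2 t0, 0 <= t0 < T & q t0 = q t.
Proof.
move=> T0 pq.
have pqn (n : nat) s : q (s + n%:R * T) = q s.
  elim: n s => [|n IH] s; first by rewrite mul0r addr0.
  by rewrite -natr1 mulrDl mul1r addrA pq IH.
have /andP[z1 z2] := floor_itv (t / T).
move: z1 z2; set z := Num.floor _; rewrite ler_pdivlMr// ltr_pdivrMr// => z1 z2.
exists (t - z%:~R * T).
  by move: z2; rewrite intrD mulrDl mul1r; lra.
case: z z1 z2 => n _ _.
  by rewrite -[in RHS](subrK (n%:R * T) t) pqn.
by rewrite NegzE mulrNz mulNr opprK -pmulrn pqn.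
Qed.

(** The estimate is made on an approximating curve, which does avoid [S]: after [t0] its distance to
    [f t0] is at most [t - t0 + d], so its potential part is at least [r * (ln (e + d) - ln d)],
    which exceeds [B] for small [d]. *)
Lemma limit_avoids_obstacle (T c B : R) (S : set (V3 R)) (Phi : R -> V3 R -> R)
    (q : nat -> R -> V3 R) (f : R -> V3 R) :
  0 < T -> closed (S : set 'rV[R]_3) -> classP T S Phi ->
  (forall t x, ~ S x -> Phi t x <= c) -> 0 <= c ->
  (forall k, lip1 (q k)) -> (forall k t, ~ S (q k t)) ->
  (forall t, f (t + T) = f t) ->
  (forall t, q k t @[k --> \oo] --> (f t : 'rV[R]_3)) ->
  (forall k, (pot T Phi c (q k) <= B%:E)%E) ->
  forall t, ~ S (f t).
Proof.
move=> T0 cS hP hc c0 lq Sq pf qf potB t1 St1.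
have [t0 /andP[t00 t0T] ft0] := periodic_reduce t1 T0 pf.
have Sx0 : S (f t0) by rewrite ft0.
have bd : (closure (S : set 'rV[R]_3) `\` interior (S : set 'rV[R]_3)) (f t0).
  split; first exact: subset_closure.
  move=> intS; have := qf t0 _ intS => -[n _ /(_ n (leqnn n))] /=.
  exact: Sq.
have [_ [_ [_ [_ [_ [_ hcol]]]]]] := hP.
have [|eps [r [eps0 [r0 Hcol]]]] := hcol (ex_intro _ _ Sx0) (f t0) t0 bd.
  by rewrite t00 ltW.
(* The cap [T - t0] keeps [[t0, t0 + e]] inside the period; it is positive because the collision
   time was reduced to [[0, T[]. *)
pose e := Num.min (eps / 2) (T - t0).
have e0 : 0 < e by rewrite lt_min divr_gt0//= subr_gt0.
have e1 : e <= eps / 2 by rewrite ge_min lexx.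
have e2 : e <= T - t0 by rewrite ge_min lexx orbT.
(* The first bound gives [e + d < eps], so the blow-up condition applies on the whole interval; the
   second makes [r * (ln e - ln d)] at least [B + 1]. *)
pose d := Num.min (eps / 4) (e * expR (- (B + 1) / r)).
have d0 : 0 < d by rewrite lt_min divr_gt0//= mulr_gt0// expR_gt0.
have d1 : d <= eps / 4 by rewrite ge_min lexx.
have [k dk] : exists k, enorm (q k t0 - f t0) <= d.
  have /cvg_enormP/cvgr0Pnorm_le/(_ _ d0)[k _ /(_ k (leqnn k))] := qf t0.
  by rewrite /= ger0_norm ?enorm_ge0// => h; exists k.
have low t : t0 <= t <= t0 + e -> r / (t - t0 + d) <= c - Phi t (q k t).
  move=> /andP[tt te].
  have h1 : enorm (q k t - f t0) <= t - t0 + d.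
    have -> : q k t - f t0 = (q k t - q k t0) + (q k t0 - f t0) by rewrite addrA subrK.
    apply: (le_trans (ler_enormD _ _)); apply: lerD => //.
    by apply: (le_trans (lq k _ _)); rewrite ger0_norm// subr_ge0.
  have n0 : 0 < enorm (q k t - f t0).
    rewrite lt_neqAle enorm_ge0 andbT eq_sym; apply/eqP => /enorm_eq0/eqP.
    by rewrite subr_eq0 => /eqP E; apply: (Sq k t); rewrite E.
  have h2 : r / enorm (q k t - f t0) <= - Phi t (q k t).
    apply: Hcol; [exact: Sq|lra|].
    by rewrite ger0_norm ?subr_ge0//; lra.
  have h3 : r / (t - t0 + d) <= r / enorm (q k t - f t0).
    by rewrite ler_pM2l// lef_pV2// posrE; lra.
  lra.
have : (\int[mu]_(t in `[t0, (t0 + e)%R]) (r / (t - t0 + d))%:E <= pot T Phi c (q k))%E.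
  have mP : measurable_fun `[0, T] (fun t => c - Phi t (q k t)).
    by apply: measurable_funB => //; exact: (Phi_curve_measurable T0 cS hP (lq k) (Sq k)).
  have sub : [set` `[t0, t0 + e]] `<=` [set` `[0, T]].
    by apply: subset_itv; rewrite bnd_simp//; lra.
  apply: (@le_trans _ _ (\int[mu]_(t in `[t0, (t0 + e)%R]) (c - Phi t (q k t))%:E)%E).
    apply: ge0_le_integral => //.
    - move=> t; rewrite /= in_itv/= => /andP[tt _]; rewrite lee_fin divr_ge0 ?(ltW r0)//; lra.
    - apply/measurable_EFinP; apply: subspace_continuous_measurable_fun => //.
      exact: inv_shift_continuous.
    - by apply/measurable_EFinP; apply: measurable_funS mP.
  apply: ge0_subset_integral => //.
  - exact/measurable_EFinP.
  - by move=> t _; rewrite lee_fin subr_ge0 hc.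
rewrite integral_inv_shift// => /le_trans/(_ (potB k)); rewrite lee_fin; apply/negP; rewrite -ltNge.
have lnd : ln d <= ln e - (B + 1) / r.
  have -> : ln e - (B + 1) / r = ln (e * expR (- (B + 1) / r)).
    by rewrite lnM ?posrE ?expR_gt0// expRK mulNr.
  by rewrite ler_ln ?posrE ?mulr_gt0 ?expR_gt0// ge_min lexx orbT.
have lne : ln e <= ln (e + d) by rewrite ler_ln ?posrE ?addr_gt0// lerDl ltW.
apply: (@lt_le_trans _ _ (r * ((B + 1) / r))).
  by rewrite mulrCA mulfV ?gt_eqF//; lra.
by rewrite ler_pM2l//; lra.
Qed.

End collision.

(** * Passage to the limit in the potential and in the Riemann sums *)

Section semicontinuity.
Variables (R : realType) (T : R) (S : set (V3 R)).
Variables (A : R -> V3 R -> V3 R) (Phi : R -> V3 R -> R) (c : R).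
Hypotheses (T0 : 0 < T) (cS : closed (S : set 'rV[R]_3)).
Hypotheses (hA : classA T A) (hP : classP T S Phi).
Hypothesis hc : forall t x, ~ S x -> Phi t x <= c.
Local Notation mu := (@lebesgue_measure R).
Variables (q : nat -> R -> V3 R) (f : R -> V3 R).
Hypotheses (lq : forall k, lip1 (q k)) (Sq : forall k t, ~ S (q k t)).
Hypothesis Sf : forall t, ~ S (f t).
Hypothesis qf : forall t, q k t @[k --> \oo] --> (f t : 'rV[R]_3).

Lemma limn_einf_le (u : nat -> \bar R) (y : nat -> R) (l : R) :
  (forall k, (u k <= (y k)%:E)%E) -> y @ \oo --> l -> (limn_einf u <= l%:E)%E.
Proof.
move=> uy yl.
have yl' : (y k)%:E @[k --> \oo] --> l%:E by apply: cvg_EFin => //; near=> k.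
rewrite limn_einf_lim -(cvg_lim _ yl')//.
apply: lee_lim; [exact: is_cvg_einfs|by apply/cvg_ex; exists l%:E|].
near=> k; apply: le_trans (uy k); apply: ereal_inf_lbound.
by exists k => /=.
Unshelve. all: by end_near. Qed.

Lemma pot_lsc : (pot T Phi c f <= limn_einf (fun k => pot T Phi c (q k)))%E.
Proof.
have mP k : measurable_fun `[0, T] (fun t => (c - Phi t (q k t))%:E).
  have mPk := Phi_curve_measurable T0 cS hP (lq k) (@Sq k).
  by apply/measurable_EFinP; exact: measurable_funB.
have P0 k t : `[0, T]%classic t -> (0 <= (c - Phi t (q k t))%:E)%E.
  by move=> _; rewrite lee_fin subr_ge0 hc.
have := @fatou _ _ _ mu `[0, T]%classic (measurable_itv _) (fun k t => (c - Phi t (q k t))%:E) mP P0.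
apply: le_trans; rewrite le_eqVlt; apply/orP; left; apply/eqP.
apply: eq_integral => t _.
have : (c - Phi t (q k t))%:E @[k --> \oo] --> (c - Phi t (f t))%:E.
  apply: cvg_EFin; first by near=> k.
  apply: cvgB; first exact: cvg_cst.
  apply: (@cvg_comp _ _ _ (fun k => q k t) (Phi t) _ (nbhs (f t : 'rV[R]_3))); first exact: qf.
  exact: (classP_continuous cS hP).
by move=> /cvg_limn_einf_sup[-> _].
Unshelve. all: by end_near. Qed.

Lemma cvg_riemann_seq (n : nat) (h : R) : 0 < h -> h * n%:R <= T ->
  riemann A (q k) n h @[k --> \oo] --> riemann A f n h.
Proof.
move=> h0; elim: n => [|n IH] hn.
  by rewrite /riemann; under eq_fun do rewrite big_ord0; rewrite big_ord0; exact: cvg_cst.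
have hn' : h * n%:R <= T by apply: le_trans hn; rewrite ler_pM2l// ler_nat.
rewrite /riemann; under eq_fun do rewrite big_ord_recr/=; rewrite big_ord_recr/=.
have dc : q k (h * n.+1%:R) - q k (h * n%:R) @[k --> \oo] --> (f (h * n.+1%:R) - f (h * n%:R) : 'rV[R]_3).
  by apply: cvgB; exact: qf.
apply: cvgD; first exact: IH.
apply: cvgD.
  apply: cvgM; first exact: cvg_cst.
  apply: (@cvg_comp _ _ _ _ (@kin R) _ (nbhs (h^-1 *: (f (h * n.+1%:R) - f (h * n%:R)) : 'rV[R]_3))).
    exact: cvgZl_tmp.
  exact: kin_continuous.
apply: cvg_dot3; first exact: dc.
have hnT : 0 <= h * n%:R <= T by rewrite hn' mulr_ge0// ltW.
by apply: (cvg_A hA) => //; exact: cvg_cst.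
Qed.

End semicontinuity.

(** * Existence of a non-constant minimizer *)

Unset Implicit Arguments.

Theorem mainTheorem10 (R : realType) (T : R) (S : set (V3 R))
  (A : R -> V3 R -> V3 R) (Phi : R -> V3 R -> R) :
  0 < T ->
  compact S ->
  classAP T S A Phi ->
  ereal_sup [set phi T Phi x | x in ~` S] = 0%E ->
  (ereal_inf [set action T S A Phi q | q in inLambda T S] < 0)%E ->
  exists qq : R -> V3 R,
    inKLambda T S qq /\
    (exists s t, qq s != qq t) /\
    action T S A Phi qq = ereal_inf [set action T S A Phi q | q in inLambda T S].
Proof.
move=> T0 cpS [hA [hP _]] supphi infneg.
have cS : closed (S : set 'rV[R]_3) by exact: compact_closed.
have [[c0 hc0] _] := hP.
(* The upper bound of [Phi] is made nonnegative, as [limit_avoids_obstacle] requires. *)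
pose c := Num.max c0 0.
have c_ge0 : 0 <= c by rewrite le_max lexx orbT.
have hc t x : ~ S x -> Phi t x <= c by move=> /hc0/le_trans; apply; rewrite le_max lexx.
have phi0 x : ~ S x -> (phi T Phi x <= 0)%E.
  by move=> Sx; rewrite -supphi; apply: ereal_sup_ubound; exists x.
have [C [C0 HC]] := classA_lip hA.
have Alip q : lip1 q -> forall s t, 0 <= s <= T -> 0 <= t <= T ->
    enorm (A t (q t) - A s (q s)) <= C * (2 * `|t - s|).
  move=> lq s t sT tT; apply: (le_trans (HC _ _ _ _ sT tT)); rewrite ler_wpM2l//.
  by have := lq t s; lra.
pose be := C * (2 * T).
have lagge q g : inKLambda T S q -> density T q g ->
    - (be * T) <= \int[lebesgue_measure]_(t in `[0, T]) lag A q g t.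
  move=> [Kq _] dg; have lq : lip1 q by exact: inK_lip Kq.
  apply: (lag_ge T0 hA lq Kq.1.2 dg) => t /andP[t_0 tT].
  apply: (le_trans (Alip q lq 0 t _ _)); [by rewrite lexx ltW|by rewrite t_0|].
  by rewrite subr0 ger0_norm// ler_wpM2l// ler_pM2l.
set m := ereal_inf _ in infneg *.
have mlb q : inLambda T S q -> (m <= action T S A Phi q)%E.
  by move=> Lq; apply: ereal_inf_lbound; exists q.
(* A crude bound, uniform in the curve, which excludes the value [-oo] for the infimum. *)
have actlb q : inLambda T S q -> ((- (be * T) - c * T)%:E <= action T S A Phi q)%E.
  move=> Lq; have [KLq|nKLq] := pselect (inKLambda T S q); last first.
    by rewrite /action asboolF// leey.
  have [g dg] := inKLambda_density T0 KLq.
  rewrite (actionE T0 cS hA hP hc KLq dg).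
  have p0 : (0 <= pot T Phi c q)%E by have [_ [_ Sq]] := KLq; exact: (@pot_ge0 _ T S Phi c hc q Sq).
  by apply: (le_trans _ (leeDl _ p0)); rewrite lee_fin lerD2r; exact: lagge.
have mfin : m \is a fin_num.
  rewrite fin_numE; apply/andP; split; last by apply/eqP => mE; move: infneg; rewrite mE.
  apply/eqP => mE.
  have : ((- (be * T) - c * T)%:E <= m)%E.
    by apply: le_ereal_inf_tmp => _ [q Lq <-]; exact: actlb.
  by rewrite mE.
pose r := fine m; have mE : m = r%:E by rewrite fineK.
have r0 : r < 0 by move: infneg; rewrite mE lte_fin.
(* These errors tend to 0 and never exceed [- r / 2]. All actions of the sequence thus stay below
   [r / 2], the level that [action_far] excludes for curves starting far away. *)
pose e (n : nat) : R := - r / 2 / n.+1%:R.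
have e0 n : 0 < e n by rewrite !divr_gt0// oppr_gt0.
have exq n : exists q : R -> V3 R,
    inKLambda T S q /\ (action T S A Phi q < (r + e n)%:E)%E.
  have : (m < (r + e n)%:E)%E by rewrite mE lte_fin ltrDl.
  move=> /ereal_inf_lt[_ [q Lq <-] qlt]; exists q; split => //.
  apply: contrapT => nKL; by move: qlt; rewrite /action asboolF.
have [q Hq] := choice exq.
have lq n : lip1 (q n) by have [[Kq _] _] := Hq n; exact: inK_lip Kq.
have r2 : 0 < - r / 2 by rewrite divr_gt0// oppr_gt0.
have [M HM] := action_far T0 cS hA hP hc r2 cpS phi0.
have qM n : enorm (q n 0) <= M.
  rewrite leNgt; apply/negP => /(HM _ (Hq n).1).
  apply/negP; rewrite -ltNge; apply: (lt_le_trans (Hq n).2); rewrite lee_fin.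
  have : e n <= - r / 2 by rewrite ler_pdivrMr// ler_peMr ?ler1n// ltW.
  lra.
have [u [f [uk lf qf]]] := lip1_subsequence lq qM.
pose p k := q (u k).
have KLp k : inKLambda T S (p k) by exact: (Hq _).1.
have Sp k t : ~ S (p k t) by have [_ [_]] := KLp k.
have actp k : (action T S A Phi (p k) <= (r + e k)%:E)%E.
  apply: (le_trans (ltW (Hq _).2)); rewrite lee_fin lerD2l ler_pM2l//.
  by rewrite lef_pV2 ?posrE// ler_nat ltnS.
have pf t : f (t + T) = f t.
  have h1 := qf (t + T); have h2 := qf t.
  have E : (fun k => q (u k) (t + T)) = (fun k => q (u k) t).
    by apply/funext => k; have [[[_ pk] _] _] := KLp k; exact: pk.
  rewrite E in h1.
  by apply: (cvg_unique _ h1 h2); exact: norm_hausdorff.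
have [g dg] := choice (fun k => inKLambda_density T0 (KLp k)).
(* A lower bound on the [lag] integral turns the near-minimality of [p k] into an upper bound on its
   potential part. It serves twice: with the crude bound [lagge], to rule out collisions, and with
   Riemann sums, for semicontinuity. *)
have potp k (x : R) : x <= \int[lebesgue_measure]_(t in `[0, T]) lag A (p k) (g k) t ->
    (pot T Phi c (p k) <= (r + e k - x + c * T)%:E)%E.
  move=> xle; have := actp k; rewrite (actionE T0 cS hA hP hc (KLp k) (dg k)).
  case: (pot T Phi c (p k)) => [y| |]//=; last by move=> _; rewrite leNye.
  rewrite -EFinD !lee_fin; move: (\int[_]_(_ in _) _) xle => *; lra.
have potB k : (pot T Phi c (p k) <= (r + e 0%N + be * T + c * T)%:E)%E.
  apply: (le_trans (potp k _ (lagge _ _ (KLp k) (dg k)))); rewrite lee_fin.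
  have : e k <= e 0%N by rewrite ler_pM2l// lef_pV2 ?posrE// ler_nat.
  lra.
have lp k : lip1 (p k) by exact: lq.
have Sf := limit_avoids_obstacle T0 cS hP hc c_ge0 lp Sp pf qf potB.
have Kf : inK T f by exact: lip_inK.
have KLf : inKLambda T S f by split => //; split => //; exact: Kf.1.
have [gf dgf] := inKLambda_density T0 KLf.
pose h (n : nat) : R := T / n.+1%:R.
have h0 n : 0 < h n by rewrite divr_gt0.
(* Here [n] is fixed and [k] tends to infinity: [e k] vanishes and the Riemann sums of [p k] tend to
   that of [f], while the error [C * (2 * h n) * T] is uniform in [k]. Only then does [n] tend to
   infinity, in [ylim]. *)
have potf n : (pot T Phi c f <= (r - riemann A f n.+1 (h n) + C * (2 * h n) * T + c * T)%:E)%E.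
  apply: (le_trans (pot_lsc T0 cS hP hc lp Sp Sf qf)).
  apply: (@limn_einf_le _ _ (fun k => r + e k - (riemann A (p k) n.+1 (h n) - C * (2 * h n) * T) + c * T)).
    move=> k; apply: potp; apply: (riemann_le T0 hA (lp k) (dg k)) => s t s0 st th tT.
    apply: (le_trans (Alip _ (lp k) s t _ _)).
    - by rewrite s0 (le_trans st tT).
    - by rewrite tT (le_trans s0 st).
    by rewrite ger0_norm ?subr_ge0// ler_wpM2l// ler_pM2l// lerBlDl.
  have -> : r - riemann A f n.+1 (h n) + C * (2 * h n) * T + c * T =
      r + 0 - (riemann A f n.+1 (h n) - C * (2 * h n) * T) + c * T by ring.
  apply: cvgD; last exact: cvg_cst.
  apply: cvgB.
    by apply: cvgD; [exact: cvg_cst|exact: cvg_step].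
  apply: cvgB; last exact: cvg_cst.
  by apply: (cvg_riemann_seq hA qf) => //; rewrite mulfVK.
have pf0 : (0 <= pot T Phi c f)%E by exact: (@pot_ge0 _ T S Phi c hc f Sf).
have [y yE] : exists y, pot T Phi c f = y%:E.
  have := potf 0%N; move: pf0; case: (pot T Phi c f) => [y| |]//= _ _; by exists y.
have ylim : y <= r - \int[lebesgue_measure]_(t in `[0, T]) lag A f gf t + C * (2 * 0) * T + c * T.
  have cv : r - riemann A f n.+1 (h n) + C * (2 * h n) * T + c * T @[n --> \oo] -->
      r - \int[lebesgue_measure]_(t in `[0, T]) lag A f gf t + C * (2 * 0) * T + c * T.
    apply: cvgD; last exact: cvg_cst.
    apply: cvgD.
      by apply: cvgB; [exact: cvg_cst|exact: (cvg_riemann T0 hA lf dgf)].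
    apply: cvgM; last exact: cvg_cst.
    apply: cvgM; first exact: cvg_cst.
    by apply: cvgM; [exact: cvg_cst|exact: cvg_step].
  by apply: (cvgr_to_ge cv); near=> n; have := potf n; rewrite yE lee_fin.
have actf : action T S A Phi f = m.
  apply/eqP; rewrite eq_le; apply/andP; split; last by apply: mlb; exact: KLf.2.
  rewrite (actionE T0 cS hA hP hc KLf dgf) yE mE -EFinD lee_fin.
  move: ylim; rewrite !mulr0 mul0r.
  move: (\int[_]_(_ in _) _) => *; lra.
exists f; split => //; split => //.
apply: contrapT => nconst.
have fE t : f t = f 0.
  by apply/eqP; apply: contrapT => /negP ft; apply: nconst; exists t, 0.
have := action_const_ge0 T0 cS hA hP hc KLf fE (phi0 _ (Sf 0)).
by rewrite actf leNgt infneg.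
Unshelve. all: by end_near. Qed.
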